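(* Let $\boldsymbol\omega_{z,z'}(t)$ be the Markov process in $\Omega$ with transition semigroup $\{T(t)\}_{t\ge0}$ described in the context. (1) The boundary z-measure $P_{z,z'}$ is the unique stationary distribution of the process, i.e. the unique probability measure $P$ on $\Omega$ with $\int T(t)f\,dP=\int f\,dP$ for all $f\in C(\Omega)$, $t\ge0$. (2) $P_{z,z'}$ is a symmetrizing measure: $\int_\Omega(T(t)f)g\,dP_{z,z'}=\int_\Omega f(T(t)g)\,dP_{z,z'}$ for all $f,g\in C(\Omega)$, $t\ge0$ (equivalently, the generator $\bar A_{z,z'}$ is symmetric in $L^2(\Omega,P_{z,z'})$ on its domain). (3) The process is ergodic: for every $f\in C(\Omega)$, $\lim_{t\to+\infty}\big\|T(t)f-\big(\int_\Omega f\,dP_{z,z'}\big)\cdot1\big\|=0$, where $\|\cdot\|$ is the sup norm on $C(\Omega)$.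
   Context: Young diagrams: $\mathbb Y_n$ is the set of Young diagrams with $n$ boxes; $\mu\nearrow\lambda$ (equivalently $\lambda\searrow\mu$) means $\mu\subset\lambda$, $|\lambda|=|\mu|+1$; $(z)_\theta=\prod_{(i,j)\in\theta}(z+j-i)$ for a (skew) diagram $\theta$ ($(i,j)$ = row $i$, column $j$), $(z)_n=z(z+1)\cdots(z+n-1)$; $\dim\lambda$ = number of standard Young tableaux of shape $\lambda$. Modified Frobenius coordinates $\lambda=(a_1,\dots,a_d\mid b_1,\dots,b_d)$: $d$ the number of diagonal boxes, $a_i=\lambda_i-i+\frac12$, $b_i=\lambda'_i-i+\frac12$. $(z,z')$ is fixed in the principal series ($z\notin\mathbb R$, $z'=\bar z$) or complementary series ($z,z'\in(N,N+1)$, $N\in\mathbb Z$). z-measure: $M_n(\lambda)=\frac{(z)_\lambda(z')_\lambda}{(zz')_n}\frac{(\dim\lambda)^2}{n!}$. $p^\downarrow(\nu,\lambda)=\dim\lambda/\dim\nu$ if $\lambda\nearrow\nu$, else 0; for $\lambda\in\mathbb Y_n$, $p^\uparrow(\lambda,\nu)=\frac{(z)_{\nu/\lambda}(z')_{\nu/\lambda}}{zz'+n}\frac{\dim\nu}{(n+1)\dim\lambda}$ if $\nu\searrow\lambda$, else 0; $(T_ng)(\lambda)=\sum_{\nu\in\mathbb Y_{n+1}}p^\uparrow(\lambda,\nu)\sum_{\tilde\lambda\in\mathbb Y_n}p^\downarrow(\nu,\tilde\lambda)g(\tilde\lambda)$ (norm $\|g\|_n=\max|g|$). Thoma simplex $\Omega$: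 pairs $\omega=(\alpha,\beta)$ of nonincreasing sequences of nonnegative reals with $\sum_i(\alpha_i+\beta_i)\le1$ (compact); $C(\Omega)$ with sup norm. $\iota_n(\lambda)$: $\alpha_i=a_i/n$, $\beta_i=b_i/n$ ($i\le d$), 0 otherwise; $\pi_nf=f\circ\iota_n$. $P_{z,z'}$ is the weak limit of $\iota_n(M_n)$. $\Lambda^\circ=\Lambda/(p_1-1)$ ($\Lambda$ = symmetric functions over $\mathbb R$, Schur functions $s_\mu$), realized as a dense subalgebra of $C(\Omega)$ via $p_1^\circ=1$, $p_k^\circ(\omega)=\sum_i\alpha_i^k+(-1)^{k-1}\sum_i\beta_i^k$ ($k\ge2$). $A_{z,z'}:\Lambda^\circ\to\Lambda^\circ$, $A_{z,z'}s^\circ_\mu=-m(m-1+zz')s^\circ_\mu+\sum_{\mu_\bullet\nearrow\mu}(z)_{\mu/\mu_\bullet}(z')_{\mu/\mu_\bullet}s^\circ_{\mu_\bullet}$ ($m=|\mu|$), satisfies $\|n^2(T_n-\mathbf 1)\pi_nf-\pi_n(A_{z,z'}f)\|_n\to0$; its closure $\bar A_{z,z'}$ in $C(\Omega)$ generates the conservative Markov semigroup $\{T(t)\}$ (strongly continuous, contractive, positivity preserving, $T(t)1=1$), which satisfies $\|T_n^{[n^2t]}\pi_nf-\pi_n(T(t)f)\|_n\to0$ for all $f\in C(\Omega)$. *)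

(* Defs.v *)
From HB Require Import structures.
From mathcomp Require Import all_boot all_order all_algebra.
From mathcomp Require Import all_classical all_reals all_analysis.
From mathcomp Require Import complex.
Set Implicit Arguments. Unset Strict Implicit. Unset Printing Implicit Defensive.
Import Order.TTheory GRing.Theory Num.Theory.
Import numFieldNormedType.Exports.
Local Open Scope classical_set_scope.
Local Open Scope ring_scope.

(* Young diagrams, represented as partitions: nonincreasing sequences  *)
(* of positive integers (row lengths).                                 *)

Definition is_partition (l : seq nat) : bool :=
  sorted geq l && all (fun x => 0 < x)%N l.

(* partitions of n with all parts <= m (fuel = n suffices) *)
Fixpoint ptn_aux (fuel n m : nat) : seq (seq nat) :=
  match n, fuel with
  | 0, _ => [:: [::]]
  | _.+1, f.+1 =>
      flatten [seq [seq k :: p | p <- ptn_aux f (n - k) k] | k <- iota 1 (minn n m)]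
  | _.+1, 0 => [::]
  end.

Definition Yn (n : nat) : seq (seq nat) := ptn_aux n n n.

Lemma Yn_sanity :
  [seq size (Yn n) | n <- iota 0 8] = [:: 1; 1; 2; 3; 5; 7; 11; 15]%N /\
  all (fun n => all (fun l => is_partition l && (sumn l == n)) (Yn n) && uniq (Yn n))
      (iota 0 8).
Proof. by vm_compute. Qed.

Definition upper (l : seq nat) : seq (seq nat) :=
  [seq incr_nth l i | i <- iota 0 (size l).+1 & is_partition (incr_nth l i)].

Definition lower (l : seq nat) : seq (seq nat) :=
  [seq m <- Yn (sumn l).-1 | l \in upper m].

(* dim l = number of standard Young tableaux of shape l, i.e. the number of
   chains  [::] ↗ ... ↗ l  (removing the box containing the largest entry). *)
Fixpoint dim_aux (fuel : nat) (l : seq nat) : nat :=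
  match fuel with
  | 0 => 1
  | f.+1 => if l is [::] then 1 else sumn [seq dim_aux f m | m <- lower l]
  end.
Definition dimY (l : seq nat) : nat := dim_aux (sumn l).+1 l.

Lemma dimY_sanity :
  [seq dimY l | l <- [:: [:: 3; 2]; [:: 2; 2; 1]; [:: 3; 1; 1]; [:: 4; 2; 1]]]
  = [:: 5; 5; 6; 35]%N.
Proof. by vm_compute. Qed.

(* (z)_theta for the skew diagram theta = l / m  (0-indexed row i, column j:
   the content of box (i+1, j+1) is j - i). *)
Definition poch_skew (C : pzRingType) (z : C) (l m : seq nat) : C :=
  \prod_(i < size l) \prod_(nth 0%N m i <= j < nth 0%N l i) (z + j%:R - i%:R).

Definition poch_diag (C : pzRingType) (z : C) (l : seq nat) : C := poch_skew z l [::].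

Definition rising (C : pzRingType) (z : C) (n : nat) : C := \prod_(k < n) (z + k%:R).

Section ZMeasures.
Variable R : realType.
Local Open Scope complex_scope.
Local Notation C := R[i].

Definition principal_series (z z' : C) : Prop :=
  complex.Im z != 0 /\ z' = z^*.
Definition complementary_series (z z' : C) : Prop :=
  exists N : int, [/\ complex.Im z = 0, complex.Im z' = 0,
     N%:~R < complex.Re z < N%:~R + 1 & N%:~R < complex.Re z' < N%:~R + 1].
Definition admissible (z z' : C) : Prop :=
  principal_series z z' \/ complementary_series z z'.

(* z-measure M_n(l) (n = |l|); the complex quantity is real for admissible
   parameters, we take its real part. *)
Definition Mz (z z' : C) (n : nat) (l : seq nat) : R :=
  complex.Re (poch_diag z l * poch_diag z' l / rising (z * z') n)
  * (dimY l)%:R ^+ 2 / (n`!)%:R.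

Definition pdown (nu l : seq nat) : R :=
  if l \in lower nu then (dimY l)%:R / (dimY nu)%:R else 0.

Definition pup (z z' : C) (l nu : seq nat) : R :=
  let n := sumn l in
  if nu \in upper l then
    complex.Re (poch_skew z nu l * poch_skew z' nu l / (z * z' + n%:R))
    * ((dimY nu)%:R / ((n.+1)%:R * (dimY l)%:R))
  else 0.

Definition Tn (z z' : C) (n : nat) (g : seq nat -> R) (l : seq nat) : R :=
  \sum_(nu <- Yn n.+1) pup z z' l nu * \sum_(lt <- Yn n) pdown nu lt * g lt.

End ZMeasures.

Section Thoma.
Variable R : realType.

Definition ambient : Type := ({ptws nat -> R} * {ptws nat -> R})%type.

Definition thoma : set ambient :=
  [set w | [/\ (forall i, 0 <= w.1 i /\ 0 <= w.2 i),
             (forall i, w.1 i.+1 <= w.1 i /\ w.2 i.+1 <= w.2 i) &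
             (\sum_(0 <= i <oo) ((w.1 i + w.2 i)%:E) <= 1)%E]].

Lemma thoma0 : ((fun _ => 0, fun _ => 0) : ambient) \in thoma.
Proof.
apply/mem_set; split => [i|i|] /=; first by rewrite lexx.
  by rewrite lexx.
rewrite (@eq_eseriesr _ _ (fun _ => 0%E)); last by move=> i _; rewrite addr0.
by rewrite eseries0 // lee01.
Qed.

Definition Omega : Type := set_type thoma.
HB.instance Definition _ := Topological.copy Omega (set_type thoma).
HB.instance Definition _ := isPointed.Build Omega (@exist ambient (fun x => x \in thoma) _ thoma0).

Definition OmegaB : Type := g_sigma_algebraType (@open Omega).
HB.instance Definition _ := Measurable.on OmegaB.

(* modified Frobenius coordinates (0-indexed: k-th coordinate is a_{k+1}) *)
Definition frob_a (l : seq nat) (k : nat) : R :=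
  if (k < nth 0 l k)%N then (nth 0 l k)%:R - k%:R - 2^-1 else 0.
Definition conj_row (l : seq nat) (k : nat) : nat := count (fun r => k < r)%N l.
Definition frob_b (l : seq nat) (k : nat) : R :=
  if (k < conj_row l k)%N then (conj_row l k)%:R - k%:R - 2^-1 else 0.

Definition iota_pt (n : nat) (l : seq nat) : ambient :=
  (fun k => frob_a l k / n%:R, fun k => frob_b l k / n%:R).

(* iota_n : Y_n -> Omega (totalised by the base point outside Omega) *)
Definition iota_n (n : nat) (l : seq nat) : Omega :=
  match pselect (iota_pt n l \in thoma) with
  | left h => exist _ (iota_pt n l) h
  | right _ => @exist ambient (fun x => x \in thoma) _ thoma0
  end.

End Thoma.

(* Main.v *)
Require Import Defs.
From HB Require Import structures.
From mathcomp Require Import all_boot all_order all_algebra.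
From mathcomp Require Import all_classical all_reals all_analysis.
From mathcomp Require Import measurable_realfun.
From mathcomp Require Import complex.
From mathcomp Require Import zify ring lra.
Import Order.TTheory GRing.Theory Num.Theory.
Import numFieldNormedType.Exports.
Set Implicit Arguments. Unset Strict Implicit. Unset Printing Implicit Defensive.
Local Open Scope classical_set_scope.
Local Open Scope ring_scope.

(** The up-down chain is T_n = U_n D_n, where D_n averages over the down
    transitions and U_n over the up transitions.  Write p = zz' and
    N_n = (n + 1)(n + p).  Kerov's identities for the contents of addable and
    removable boxes give the commutation relation
      N_(n+1) U_(n+1) D_(n+1) = N_n D_n U_n + (N_(n+1) - N_n).
    Let K_m be the operator on functions on Y_n that goes down from Y_n to Y_m
    and back up.  The relation yields
      N_n (T_n K_m - K_m) = N_(m-1) (K_(m-1) - K_m),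
    so T_n moves the level m by a pure death chain started at K_n = 1 and
    absorbed at K_1 = <M_n, .>.  Deaths occur with probability
    m (m - 1 + p) / N_n, hence 1 - 1/m is contracted by 1 - 1/N_n at each step,
    and T_n^k is within 4 (1 - 1/N_n)^k of the z-average M_n in the sup norm.
    With k = [n^2 t] this is O(1/t) uniformly in n, and it passes to the limit
    because the points iota_n(Y_n) accumulate at every point of Omega.
    Stationarity and symmetry are limits of the detailed balance of M_n;
    uniqueness follows from ergodicity. *)

(** * Partitions *)

Section Partitions.
Local Open Scope nat_scope.
Implicit Types (l nu : seq nat) (f : nat -> nat).

Lemma partitionP l :
  reflect ((forall i, nth 0 l i.+1 <= nth 0 l i)
           /\ (forall i, i < size l -> 0 < nth 0 l i)) (is_partition l).
Proof.
apply: (iffP andP) => [[srt pos]|[dec pos]]; split.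
- move=> i; case: (ltnP i.+1 (size l)) => [ltil|/(nth_default 0)->//].
  have := @sorted_leq_nth _ geq (fun a b c ab bc => leq_trans bc ab) leqnn 0 l srt.
  by move=> /(_ i i.+1); rewrite !inE => /(_ (ltnW ltil) ltil (leqnSn i)).
- by move=> i ltil; apply: (allP pos); apply: mem_nth.
- apply/(sortedP 0) => i ltil; exact: dec.
- by apply/(all_nthP 0) => i ltil; apply: pos.
Qed.

Lemma nth_partition_le l i j :
  is_partition l -> i <= j -> nth 0 l j <= nth 0 l i.
Proof.
move=> /partitionP [dec _]; elim: j => [|j IH]; first by rewrite leqn0 => /eqP->.
by rewrite leq_eqVlt => /predU1P[->//|/IH]; apply: leq_trans.
Qed.

Lemma partition_gt0 l i : is_partition l -> (0 < nth 0 l i) = (i < size l).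
Proof.
move=> /partitionP [_ pos]; case: (ltnP i (size l)) => [/pos//|/(nth_default 0)->//].
Qed.

Lemma partition_eq l m :
  is_partition l -> is_partition m -> nth 0 l =1 nth 0 m -> l = m.
Proof.
move=> Pl Pm E; apply: (@eq_from_nth _ 0) => [|i _]; last exact: E.
have sz i : (i < size l) = (i < size m) by rewrite -!partition_gt0 // E.
by apply/eqP; rewrite eqn_leq; have := sz (size l); have := sz (size m); lia.
Qed.

(** Diagrams are built below from functions giving the row lengths. Since [f] is nonincreasing,
    cutting it at its first zero keeps exactly the positive parts. *)
Lemma partition_of_fun f n : (forall i, f i.+1 <= f i) -> f n = 0 ->
  exists2 l, is_partition l & nth 0 l =1 f.
Proof.
move=> dec fn0.
have ex0 : exists i, f i == 0 by exists n; apply/eqP.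
have [k /eqP fk0 kmin] := ex_minnP ex0.
have fz i : k <= i -> f i = 0.
  elim: i => [|i IH]; first by rewrite leqn0 => /eqP k0; rewrite -{1}k0.
  rewrite leq_eqVlt => /predU1P[<-//|/IH fi0].
  by apply/eqP; rewrite -leqn0 -fi0.
have nthE : nth 0 (mkseq f k) =1 f.
  move=> i; case: (ltnP i k) => [ik|ki]; first by rewrite nth_mkseq.
  by rewrite nth_default ?size_mkseq// fz.
exists (mkseq f k) => //; apply/partitionP; split => i; rewrite !nthE //.
rewrite size_mkseq lt0n => ik; apply/negP => /kmin; lia.
Qed.

Lemma sumnE_nth l n : size l <= n -> sumn l = \sum_(i < n) nth 0 l i.
Proof.
elim: l n => [|x l IH] [|n] //=; first by rewrite big_ord0.
  by rewrite big1 // => i _; rewrite nth_nil.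
by rewrite ltnS => /IH ->; rewrite big_ord_recl.
Qed.

(** Fuel [n] is enough because every row removed has at least one box. As parts are nonincreasing,
    the bound on the first part bounds them all. *)
Lemma ptn_auxP fuel n m l : n <= fuel ->
  (l \in ptn_aux fuel n m) = [&& is_partition l, sumn l == n & head 0 l <= m].
Proof.
elim: fuel n m l => [|fuel IH] [|n] m l //=.
- move=> _; rewrite inE; case: l => [|x l] //=.
  by rewrite /is_partition /=; case: x => [|x]; rewrite ?andbF //= addSn !andbF.
- move=> _; rewrite inE; case: l => [|x l] //=.
  by rewrite /is_partition /=; case: x => [|x]; rewrite ?andbF //= addSn !andbF.
rewrite ltnS => nf; apply/flatten_mapP/idP.
  case=> k; rewrite mem_iota => kb /mapP[q].
  rewrite IH; last lia.
  case/and3P => Pq /eqP sq hq -> /=; rewrite sq.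
  have -> : k + (n.+1 - k) == n.+1 by lia.
  have -> : k <= m by lia.
  rewrite !andbT; case/andP: Pq => srt pos; apply/andP; split => /=.
    by case: q srt hq {sq pos} => //= y q -> ->.
  by rewrite pos andbT; lia.
case: l => [|k q] /=; first by [].
case/and3P => /andP[/= srt /andP[k0 pos]] /eqP sq km.
exists k; first by rewrite mem_iota; lia.
apply: map_f; rewrite IH; last lia.
apply/and3P; split; [|lia|].
  by apply/andP; split => //; apply: path_sorted srt.
by case: q srt {sq pos} => //= y q /andP[].
Qed.

Lemma mem_Yn n l : (l \in Yn n) = is_partition l && (sumn l == n).
Proof.
rewrite /Yn ptn_auxP //; case: (@andP (is_partition l) (sumn l == n)) => [[Pl /eqP sl]|nP].
  by rewrite Pl sl eqxx /=; case: l sl {Pl} => //= x l <-; rewrite leq_addr.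
by apply/and3P => -[Pl sl _]; apply: nP.
Qed.

Lemma uniq_Yn n : uniq (Yn n).
Proof.
rewrite /Yn; move: {2}n {1}n => m k; elim: k n m => [|fuel IH] [|n] m //=.
move: (minn _ _) => k; elim: k 1 => [|k IHk] j //=.
rewrite cat_uniq IHk map_inj_uniq ?IH; last by move=> a b [].
rewrite andbT /=; apply/hasPn => x /allpairsPdep[i [q []]]; rewrite mem_iota => ij _ ->.
by apply/negP => /mapP[r _ [E _]]; lia.
Qed.

Lemma mem_upper l nu :
  reflect (exists2 i, nu = incr_nth l i & is_partition nu) (nu \in upper l).
Proof.
apply: (iffP mapP) => [[i + ->]|[i -> P]].
  by rewrite mem_filter => /andP[P _]; exists i.
exists i => //; rewrite mem_filter P mem_iota add0n ltnS /= leqNgt.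
(* A box added further down than index [size l] would leave a zero part at that index. *)
apply/negP => il; move: P => /partitionP[_ /(_ (size l))].
rewrite size_incr_nth [i < _]ltnNge (ltnW il) /= nth_incr_nth nth_default //.
by rewrite ltnS => /(_ (ltnW il)); case: eqP => //; lia.
Qed.

Lemma sumn_incr l i : sumn (incr_nth l i) = (sumn l).+1.
Proof.
elim: l i => [|x l IH] [|i] //=; last by rewrite IH addnS.
by elim: i => //= i ->.
Qed.

Lemma sumn_upper l nu : nu \in upper l -> sumn nu = (sumn l).+1.
Proof. by case/mem_upper => i -> _; rewrite sumn_incr. Qed.

Lemma upper_partition l nu : nu \in upper l -> is_partition nu.
Proof. by case/mem_upper. Qed.

Lemma upper_Yn n l nu : l \in Yn n -> nu \in upper l -> nu \in Yn n.+1.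
Proof.
rewrite mem_Yn => /andP[_ /eqP <-] ul.
by rewrite mem_Yn (upper_partition ul) (sumn_upper ul) eqxx.
Qed.

Lemma mem_lower n l nu :
  nu \in Yn n.+1 -> (l \in lower nu) = (l \in Yn n) && (nu \in upper l).
Proof. by rewrite mem_Yn => /andP[_ /eqP s]; rewrite mem_filter s andbC. Qed.

Lemma incr_nth_inj l i j : incr_nth l i = incr_nth l j -> i = j.
Proof.
move=> /(congr1 (fun s => nth 0 s i)); rewrite !nth_incr_nth eqxx.
by case: eqP => // _; lia.
Qed.

(** [incr_nth] pads with zeros, so the equation determines [l] and [m] only up to trailing zeros,
    and partitions have none. *)
Lemma incr_nth_injl l m i :
  is_partition l -> is_partition m -> incr_nth l i = incr_nth m i -> l = m.
Proof.
move=> Pl Pm E; apply: partition_eq => // k.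
by have := congr1 (fun s => nth 0 s k) E; rewrite !nth_incr_nth => /addnI.
Qed.

Lemma uniq_upper l : uniq (upper l).
Proof.
by rewrite map_inj_uniq ?filter_uniq ?iota_uniq // => i j; apply: incr_nth_inj.
Qed.

Lemma incr_partition l i : is_partition l ->
  is_partition (incr_nth l i) = (i == 0) || (nth 0 l i < nth 0 l i.-1).
Proof.
move=> Pl; apply/partitionP/idP => [[dec pos]|].
  case: i dec pos => //= i dec _; move: (dec i); rewrite !nth_incr_nth eqxx.
  by case: eqP => //; lia.
have /partitionP[dec pos] := Pl.
move=> H; split => k.
  rewrite !nth_incr_nth; have := dec k; case: (i =P k.+1) H => [->|_] /=; last lia.
  lia.
rewrite size_incr_nth nth_incr_nth; case: (i =P k) => //= nik.
case: (ltnP i (size l)) => il; rewrite add0n; first exact: pos.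
have ? : i <= size l.
  case/predU1P: H => [->//|]; case: i il {nik} => //= i il.
  by rewrite [in _ < _]leqNgt; case: (ltnP i (size l)) => //; move=> /(nth_default 0) ->.
by move=> ?; apply: pos; lia.
Qed.

Lemma ex_removed l i : is_partition l -> nth 0 l i.+1 < nth 0 l i ->
  exists2 m, is_partition m & incr_nth m i = l.
Proof.
move=> Pl H; have /partitionP[dec pos] := Pl.
have [|| m Pm nm] := @partition_of_fun (fun k => nth 0 l k - (k == i)) (size l).
- move=> k; have := dec k; case: (k.+1 =P i); case: (k =P i) => [->|]; lia.
- by rewrite nth_default.
exists m => //; apply: partition_eq => //.
  rewrite incr_partition // !nm; case: i H nm => //= i H _.
  by rewrite eqxx; have := dec i; case: eqP; lia.
by move=> k; rewrite nth_incr_nth nm eq_sym; case: eqP => [->|]; lia.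
Qed.

(** The last box of the last row can always be removed. *)
Lemma lower_neq_nil n nu : nu \in Yn n.+1 -> exists m, m \in lower nu.
Proof.
move=> nuY; have := nuY; rewrite mem_Yn => /andP[Pnu /eqP snu].
have n0 : 0 < size nu by case: nu snu {Pnu nuY}.
have [||m Pm E] := @ex_removed nu (size nu).-1 => //.
  by rewrite prednK // nth_default // partition_gt0 // prednK.
exists m; rewrite (mem_lower _ nuY) mem_Yn Pm /=.
move: snu; rewrite -{1}E sumn_incr => -[->]; rewrite eqxx /=.
by apply/mem_upper; exists (size nu).-1; rewrite ?E.
Qed.

(** Removing a box lowers both the fuel and the number of boxes by one, so the recursive calls carry
    exactly the fuel that [dimY] prescribes. *)
Lemma dimY_rec n nu : nu \in Yn n.+1 -> dimY nu = \sum_(m <- lower nu) dimY m.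
Proof.
rewrite mem_Yn => /andP[_ /eqP s].
have nuE : nu != [::] by case: nu s.
rewrite {1}/dimY s; case: nu s nuE => // x nu s _.
have -> : dim_aux n.+2 (x :: nu) = sumn [seq dim_aux n.+1 m | m <- lower (x :: nu)] by [].
rewrite sumnE big_map; apply: eq_big_seq => m.
by rewrite mem_filter mem_Yn s -pred_Sn => /and3P[_ _ /eqP sm]; rewrite /dimY sm.
Qed.

Lemma dimY_gt0 n l : l \in Yn n -> 0 < dimY l.
Proof.
elim: n l => [|n IH] l.
  by rewrite mem_Yn => /andP[Pl /eqP]; case: l Pl => //= -[|x] l /andP[].
move=> lY; rewrite (dimY_rec lY); have [m mlow] := lower_neq_nil lY.
have mY : m \in Yn n by move: mlow; rewrite (mem_lower _ lY) => /andP[].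
rewrite (perm_big _ (perm_to_rem mlow)) big_cons.
by rewrite /= addn_gt0 (IH _ mY).
Qed.

Lemma Yn0 : Yn 0 = [:: [::]]. Proof. by []. Qed.
Lemma Yn1 : Yn 1 = [:: [:: 1]]. Proof. by []. Qed.

(* For distinct diagrams [l] and [l'] this says both that their union is
   obtained from each by adding one box, and that their intersection is
   obtained from each by removing one. *)
Definition shifted l l' i j := forall k, nth 0 l k + (i == k) = nth 0 l' k + (j == k).

(** The diagram [l'] already has the extra box in row [i], and its row [i - 1] is no longer than
    that of [l]; hence [l] can take this box. The same holds with the roles exchanged. *)
Lemma shifted_upper l l' i j : is_partition l -> is_partition l' ->
  l != l' -> shifted l l' i j ->
  is_partition (incr_nth l i) /\ incr_nth l i = incr_nth l' j.
Proof.
move=> Pl Pl' /eqP nll S.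
have nij : i <> j.
  move=> E; apply: nll; apply: partition_eq => // k; have := S k; rewrite E; lia.
have P1 : is_partition (incr_nth l i).
  rewrite incr_partition //; case: i S nij => //= i S nij.
  have /partitionP[d _] := Pl; have /partitionP[d' _] := Pl'.
  move: (S i) (S i.+1) (d i) (d' i); rewrite eqxx.
  case: (i.+1 =P i); case: (j =P i); case: (j =P i.+1); lia.
have P2 : is_partition (incr_nth l' j).
  have /partitionP[d _] := Pl; have /partitionP[d' _] := Pl'.
  rewrite incr_partition //; case: j S nij => //= j S nij.
  move: (S j) (S j.+1) (d j) (d' j); rewrite eqxx.
  case: (j.+1 =P j); case: (i =P j); case: (i =P j.+1); lia.
by split => //; apply: partition_eq => // k; rewrite !nth_incr_nth; have := S k; lia.
Qed.

(** Row [j] of [l] has one box more than row [j] of [l'], while row [j + 1] of [l] is no longer than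
    that of [l']; so this box can be removed from [l]. *)
Lemma shifted_lower l l' i j : is_partition l -> is_partition l' ->
  l != l' -> shifted l l' i j ->
  exists2 m, is_partition m & incr_nth m j = l /\ incr_nth m i = l'.
Proof.
move=> Pl Pl' /eqP nll S.
have nij : i <> j.
  move=> E; apply: nll; apply: partition_eq => // k; have := S k; rewrite E; lia.
have [m Pm E] : exists2 m, is_partition m & incr_nth m j = l.
  have /partitionP[d _] := Pl; have /partitionP[d' _] := Pl'.
  apply: ex_removed => //; move: (S j) (S j.+1) (d j) (d' j); rewrite eqxx.
  case: (j =P j.+1); case: (i =P j); case: (i =P j.+1); lia.
exists m => //; split => //.
have mk k : nth 0 l k = (j == k) + nth 0 m k by rewrite -E nth_incr_nth.
apply: partition_eq => //; last first.
  by move=> k; rewrite !nth_incr_nth; have := S k; rewrite mk; lia.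
have /partitionP[d' _] := Pl'.
rewrite incr_partition //; case: i S nij => //= i S nij.
have /partitionP[d'' _] := Pm.
move: (S i) (S i.+1) (mk i) (mk i.+1) (d' i) (d'' i); rewrite eqxx.
case: (i.+1 =P i); case: (j =P i); case: (j =P i.+1); lia.
Qed.

End Partitions.

(** * Contents of addable and removable boxes *)

Lemma big_seq_unique (V : nmodType) (I : eqType) (s : seq I) (P : pred I)
    (F : I -> V) x :
  uniq s -> x \in s -> P x -> (forall y, y \in s -> P y -> y = x) ->
  \sum_(y <- s | P y) F y = F x.
Proof.
move=> us xs Px H; rewrite big_mkcond (bigD1_seq x) //= Px.
rewrite big1_seq ?addr0 // => y /andP[yx ys].
by case: ifP => // /(H _ ys) yE; rewrite yE eqxx in yx.
Qed.

Section ContentSum.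
Variables (R : realType) (s p : R).

(** With [s = z + z'] and [p = zz'] this is [(z + x)(z' + x)], the factor that a box of content [x]
    contributes, kept as a real polynomial. *)
Definition wgt (x : R) : R := x ^+ 2 + s * x + p.

(* For row lengths [u], row [i + 1] has an addable box exactly when row [i] has
   a removable one, and otherwise the two contents below coincide: the left-hand
   side is the sum over addable boxes (but that of row 0) minus the sum over
   removable ones. *)
Lemma wgt_telescope (u : nat -> nat) k :
  \sum_(i < k) (wgt ((u i.+1)%:R - i%:R - 1) - wgt ((u i)%:R - 1 - i%:R))
  = wgt ((u k)%:R - k%:R) - wgt (u 0%N)%:R
    + 2 * (\sum_(i < k) u i)%:R - k%:R ^+ 2 + s * k%:R.
Proof.
elim: k => [|k IH]; first by rewrite !big_ord0 /wgt; ring.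
rewrite !big_ord_recr /= IH natrD -[in (k.+1)%:R]addn1 natrD /wgt.
by ring.
Qed.

End ContentSum.

(** * Weights of single boxes and Kerov's identities *)

Section UpDownChain.
Variables (R : realType) (z z' : R[i]).
Hypothesis adm : admissible z z'.
Local Open Scope complex_scope.

Local Notation s := (complex.Re (z + z')).
Local Notation p := (complex.Re (z * z')).
Local Notation w := (wgt s p).

(** In both series [z + z'] and [zz'] are real, so passing to real parts loses nothing. *)
Lemma wgt_complex (x : R) : (z + x%:C) * (z' + x%:C) = (w x)%:C.
Proof.
apply/eqP; rewrite eq_complex /wgt; move: adm.
case: z z' => [a b] [c d] [[/= b0 [-> ->]]|[N [/= -> -> _ _]]].
  by apply/andP; split; apply/eqP => /=; ring.
by apply/andP; split; apply/eqP => /=; ring.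
Qed.

Lemma zz_real : z * z' = p%:C.
Proof. by have := wgt_complex 0; rewrite /wgt rmorph0 !addr0 expr0n mulr0 !add0r. Qed.

(** In the principal series the value is [(c + a) ^+ 2 + b ^+ 2] with [b] nonzero. In the
    complementary series [- c] is not strictly between [N] and [N + 1], so [c + z] and [c + z'] have
    the same sign. *)
Lemma wgt_gt0 (c : int) : 0 < w c%:~R.
Proof.
rewrite /wgt; move: adm; case: z z' => [a b] [a' b'] [[/= b0 [-> ->]]|[N [/= -> -> /andP[Na aN] /andP[Na' aN']]]].
  have -> : c%:~R ^+ 2 + (a + a) * c%:~R + (a * a - b * - b) = (c%:~R + a) ^+ 2 + b ^+ 2 :> R by ring.
  by rewrite ltr_wpDl ?sqr_ge0 // exprn_even_gt0.
have -> : c%:~R ^+ 2 + (a + a') * c%:~R + (a * a' - 0 * 0) = (c%:~R + a) * (c%:~R + a') :> R by ring.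
have [Nc|Nc] := leP 0 (c + N).
  have : 0 <= (c%:~R + N%:~R : R) by rewrite -intrD ler0z.
  by move=> h; apply: mulr_gt0; lra.
have : (c%:~R + N%:~R + 1 <= 0 :> R).
  by rewrite -(intrD _ c) -(intrD _ _ 1) lerz0; lia.
by move=> h; rewrite -mulrNN; apply: mulr_gt0; lra.
Qed.

Lemma p_gt0 : 0 < p.
Proof. by have := wgt_gt0 0; rewrite /wgt expr0n mulr0 !add0r. Qed.

Lemma p_addn_gt0 n : 0 < p + n%:R.
Proof. by rewrite ltr_pwDl ?p_gt0. Qed.

(** The content of the box that would be added to row [i], not of one already present. *)
Let content (l : seq nat) i : R := (nth 0%N l i)%:R - i%:R.

Lemma content_wgt_gt0 i j : 0 < w (j%:R - i%:R).
Proof.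
have -> : j%:R - i%:R = (j%:Z - i%:Z)%:~R :> R by rewrite intrB.
exact: wgt_gt0.
Qed.

Lemma poch_skew_incr (y : R[i]) l i :
  poch_skew y (incr_nth l i) l = y + (content l i)%:C.
Proof.
rewrite /poch_skew.
have isz : (i < size (incr_nth l i))%N by rewrite size_incr_nth; case: ifP.
rewrite (bigD1 (Ordinal isz)) //= [X in _ * X]big1 => [|k ki]; last first.
  rewrite nth_incr_nth (_ : (i == k) = false) ?add0n ?big_geq //.
  by apply: contraNF ki => /eqP E; apply/eqP/val_inj.
by rewrite nth_incr_nth eqxx add1n big_nat1 mulr1 rmorphB /= !rmorph_nat addrA.
Qed.

Definition wt (l nu : seq nat) : R :=
  complex.Re (poch_skew z nu l * poch_skew z' nu l).

Lemma wt_incr l i : wt l (incr_nth l i) = w (content l i).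
Proof. by rewrite /wt !poch_skew_incr wgt_complex. Qed.

Lemma wt_complex l nu : nu \in upper l ->
  poch_skew z nu l * poch_skew z' nu l = (wt l nu)%:C.
Proof. by case/mem_upper => i -> _; rewrite wt_incr !poch_skew_incr wgt_complex. Qed.

Lemma wt_gt0 l nu : nu \in upper l -> 0 < wt l nu.
Proof. by case/mem_upper => i -> _; rewrite wt_incr content_wgt_gt0. Qed.

Lemma pup_wt n l nu : l \in Yn n -> nu \in upper l ->
  pup z z' l nu = wt l nu / (p + n%:R) * ((dimY nu)%:R / ((n.+1)%:R * (dimY l)%:R)).
Proof.
rewrite mem_Yn => /andP[_ /eqP sl] ul.
rewrite /pup ul sl wt_complex // zz_real; congr (_ * _).
by rewrite -(rmorph_nat (real_complex R)) -rmorphD -fmorph_div.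
Qed.

Lemma pup_ge0 n l nu : l \in Yn n -> 0 <= pup z z' l nu.
Proof.
move=> lY; have [ul|/negbTE ul] := boolP (nu \in upper l); last by rewrite /pup ul.
rewrite (pup_wt lY ul) mulr_ge0 ?divr_ge0 ?mulr_ge0 //; first exact/ltW/wt_gt0.
exact/ltW/p_addn_gt0.
Qed.

Lemma pdown_ge0 nu l : 0 <= pdown R nu l.
Proof. by rewrite /pdown; case: ifP => // _; rewrite divr_ge0. Qed.

(* The box added to [l] to reach the union of [l] and [l'] is the one added to
   their intersection to reach [l']. *)
Lemma sum_wt_offdiag n l l' : l \in Yn n.+1 -> l' \in Yn n.+1 -> l != l' ->
  \sum_(nu <- Yn n.+2 | (nu \in upper l) && (nu \in upper l')) wt l nu
  = \sum_(m <- Yn n | (l \in upper m) && (l' \in upper m)) wt m l'.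
Proof.
move=> lY lY' nll; have := lY; rewrite mem_Yn => /andP[Pl /eqP sl].
have := lY'; rewrite mem_Yn => /andP[Pl' /eqP sl'].
(* Unless one box is moved from [l] to obtain [l'], both sums are empty; otherwise each has a single
   term. *)
have [[i [j S]]|nS] := pselect (exists i j, shifted l l' i j); last first.
  rewrite !big1_seq // => x /andP[/andP[/mem_upper[i Ei Pi] /mem_upper[j Ej Pj]] _];
    case: nS.
    by exists j, i => k; rewrite Ei Ej !nth_incr_nth; lia.
  by exists i, j => k; move: Ej; rewrite Ei => /(congr1 (fun t => nth 0%N t k)); rewrite !nth_incr_nth; lia.
have nij : i != j.
  apply/eqP => E; move/eqP: nll; apply; apply: partition_eq => // k.
  by have := S k; rewrite E; lia.
have [P1 E1] := shifted_upper Pl Pl' nll S.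
have [m Pm [E2 E3]] := shifted_lower Pl Pl' nll S.
have ul : incr_nth l i \in upper l by apply/mem_upper; exists i.
have ul' : incr_nth l i \in upper l' by apply/mem_upper; exists j.
have um : l \in upper m by apply/mem_upper; exists j.
have um' : l' \in upper m by apply/mem_upper; exists i.
rewrite (@big_seq_unique _ _ _ _ _ (incr_nth l i)) ?uniq_Yn ?ul ?ul' //; last 2 first.
- exact: upper_Yn ul.
- move=> nu _ /andP[/mem_upper[a Ea Pa] /mem_upper[b Eb Pb]].
  rewrite Ea; congr (incr_nth l _).
  have : nth 0%N (incr_nth l a) i = nth 0%N (incr_nth l' b) i by rewrite -Ea Eb.
  have := S i; rewrite !nth_incr_nth eqxx [j == i]eq_sym (negbTE nij).
  by case: (a =P i) => // _; case: (b == i); clear; lia.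
rewrite (@big_seq_unique _ _ _ _ _ m) ?uniq_Yn ?um ?um' //; last 2 first.
- rewrite mem_Yn Pm /=; move: sl; rewrite -E2 sumn_incr => -[->]; exact: eqxx.
- move=> m' m'Y /andP[/mem_upper[a Ea _] /mem_upper[b Eb _]].
  have Pm' : is_partition m' by move: m'Y; rewrite mem_Yn => /andP[].
  have aj : a = j.
    have := S j; rewrite eqxx (negbTE nij) Ea Eb !nth_incr_nth.
    by case: (a =P j) => // _; case: (b == j); clear; lia.
  by apply: (@incr_nth_injl _ _ j) => //; rewrite E2 Ea aj.
rewrite wt_incr -E3 wt_incr; congr (w _); rewrite /content -E2 nth_incr_nth.
by rewrite eq_sym (negbTE nij).
Qed.

Lemma sum_wt_upper l : is_partition l ->
  \sum_(nu <- upper l) wt l nu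
  = w (nth 0%N l 0)%:R
    + \sum_(i < size l | (nth 0 l i.+1 < nth 0 l i)%N) w ((nth 0%N l i.+1)%:R - i%:R - 1).
Proof.
move=> Pl; rewrite /upper big_map big_filter -[(size l).+1]subn0 -/(index_iota _ _).
rewrite big_mkord big_mkcond big_ord_recl /= incr_partition // eqxx wt_incr /content subr0.
congr (_ + _); rewrite [in RHS]big_mkcond; apply: eq_bigr => i _.
rewrite incr_partition //= /bump add1n /=; case: ifP => // _.
by rewrite wt_incr /content -[i.+1]addn1 natrD opprD addrA.
Qed.

Lemma sum_wt_lower n l : l \in Yn n.+1 ->
  \sum_(m <- Yn n | l \in upper m) wt m l
  = \sum_(i < size l | (nth 0 l i.+1 < nth 0 l i)%N) w ((nth 0%N l i)%:R - 1 - i%:R).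
Proof.
rewrite mem_Yn => /andP[Pl /eqP sl]; rewrite big_mkcond.
(* Double counting of pairs [(m, i)]: each lower neighbour comes from exactly one row, and each row
   yields a neighbour exactly when it is longer than the next one. *)
pose F (m : seq nat) (i : 'I_(size l)) : R :=
  if incr_nth m i == l then w ((nth 0%N l i)%:R - 1 - i%:R) else 0.
rewrite (eq_big_seq (fun m => \sum_(i < size l) F m i)) => [|m mY]; last first.
  case: ifPn => [/mem_upper[i E _]|nu].
    have il : (i < size l)%N by rewrite E size_incr_nth; case: ifP.
    rewrite (bigD1 (Ordinal il)) //= big1 ?addr0.
      rewrite /F /= E eqxx wt_incr /content nth_incr_nth eqxx.
      by rewrite add1n -addn1 natrD addrK.
    move=> j ji; rewrite /F; case: eqP => // Ej; have /incr_nth_inj Eji := etrans Ej E.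
    by case/eqP: ji; apply/val_inj.
  rewrite big1 // => i _; rewrite /F; case: eqP => // E.
  by case/negP: nu; apply/mem_upper; exists i.
rewrite exchange_big [RHS]big_mkcond; apply: eq_bigr => i _ /=.
rewrite -big_mkcond /=; case: ifPn => [lt|nlt].
  have [m Pm E] := ex_removed Pl lt.
  apply: (@big_seq_unique _ _ _ _ _ m) => //; first exact: uniq_Yn.
  - by rewrite mem_Yn Pm; move: sl; rewrite -E sumn_incr => -[->] /=.
  - exact/eqP.
  - move=> m'; rewrite mem_Yn => /andP[Pm' _] /eqP E'.
    by apply: (@incr_nth_injl _ _ i) => //; rewrite E.
rewrite big1_seq // => m /andP[/eqP E]; rewrite mem_Yn => /andP[/partitionP[d _] _].
case/negP: nlt; move: (nat_of_ord i) E => k <-; rewrite !nth_incr_nth eqxx.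
by have := d k; case: eqP => //; lia.
Qed.

(** The telescoped sum is taken over all rows of [l]; a row equal to the next one contributes
    nothing. At [k = size l] the end term [w (- k)] cancels [- k ^+ 2 + s * k] up to [p], and the
    box addable to row 0 cancels the initial term. *)
Lemma sum_wt_diag n l : l \in Yn n.+1 ->
  \sum_(nu <- Yn n.+2 | nu \in upper l) wt l nu
  = \sum_(m <- Yn n | l \in upper m) wt m l + (2 * n.+1%:R + p).
Proof.
move=> lY; have := lY; rewrite mem_Yn => /andP[Pl /eqP sl].
rewrite (sum_wt_lower lY) -big_filter (perm_big (upper l)); last first.
  apply: uniq_perm; rewrite ?filter_uniq ?uniq_Yn ?uniq_upper // => nu.
  by rewrite mem_filter; case: (boolP (nu \in upper l)) => // /(upper_Yn lY) ->.
rewrite /= sum_wt_upper //.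
have := wgt_telescope s p (nth 0%N l) (size l).
rewrite -(@sumnE_nth l (size l)) // sl [nth _ _ (size l)]nth_default //.
set D := (X in X = _ -> _); set A := \sum_(i < _ | _) _; set B := \sum_(i < _ | _) _.
have -> : D = A - B.
  rewrite /A /B big_mkcond [in X in _ = _ - X]big_mkcond -sumrB; apply: eq_bigr => i _.
  case: ifPn => // nlt; rewrite subr0; have := nth_partition_le Pl (leqnSn i).
  rewrite leq_eqVlt (negbTE nlt) orbF => /eqP ->.
  by rewrite [X in w X - _]addrAC subrr.
by move=> /(canRL (subrK _)) ->; rewrite /wgt; ring.
Qed.

(** * The up-down chain *)

Definition upop (n : nat) (h : seq nat -> R) (l : seq nat) : R :=
  \sum_(nu <- Yn n.+1) pup z z' l nu * h nu.

Definition downop (n : nat) (g : seq nat -> R) (nu : seq nat) : R :=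
  \sum_(l <- Yn n) pdown R nu l * g l.

Definition levelN (n : nat) : R := n.+1%:R * (p + n%:R).

Local Notation T := (Tn z z').

Lemma TnE n g l : T n g l = upop n (downop n g) l. Proof. by []. Qed.

Lemma dimY_neq0 n l : l \in Yn n -> (dimY l)%:R != 0 :> R.
Proof. by move=> /dimY_gt0; rewrite pnatr_eq0 lt0n. Qed.

Lemma p_addn_neq0 n : p + n%:R != 0.
Proof. by rewrite gt_eqF ?p_addn_gt0. Qed.

Lemma levelN_gt0 n : 0 < levelN n.
Proof. by rewrite mulr_gt0 ?p_addn_gt0. Qed.

Lemma levelN_ge1 n : 1 <= levelN n.+1.
Proof.
rewrite /levelN -[leLHS]mulr1 ler_pM // ?ler1n //.
by rewrite -natr1 addrA lerDr addr_ge0 ?(ltW p_gt0).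
Qed.

Lemma levelNS n : levelN n.+1 = levelN n + (2 * n.+1%:R + p).
Proof. by rewrite /levelN -!natr1; ring. Qed.

(** The dimension of the intermediate diagram cancels, here and in [down_up_entry], and both kernels
    keep the same ratio [dimY l' / dimY l]. They can then be compared through their weights
    alone. *)
Lemma up_down_entry n l l' : l \in Yn n -> l' \in Yn n ->
  levelN n * (\sum_(nu <- Yn n.+1) pup z z' l nu * pdown R nu l')
  = (dimY l')%:R / (dimY l)%:R
    * \sum_(nu <- Yn n.+1 | (nu \in upper l) && (nu \in upper l')) wt l nu.
Proof.
move=> lY lY'; rewrite !mulr_sumr [RHS]big_mkcond; apply: eq_big_seq => nu nuY.
rewrite /pdown (mem_lower _ nuY) lY' /=.
have [ul|nul] := boolP (nu \in upper l); last by rewrite /pup (negbTE nul) /= mul0r mulr0.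
case: ifP => ul'; last by rewrite !mulr0.
rewrite (pup_wt lY ul) /levelN.
have := p_addn_neq0 n; have := dimY_neq0 lY; have := dimY_neq0 nuY => ? ? ?.
by field; do ?[apply/andP; split] => //; rewrite addrC natr1.
Qed.

Lemma down_up_entry n l l' : l \in Yn n.+1 -> l' \in Yn n.+1 ->
  levelN n * (\sum_(m <- Yn n) pdown R l m * pup z z' m l')
  = (dimY l')%:R / (dimY l)%:R
    * \sum_(m <- Yn n | (l \in upper m) && (l' \in upper m)) wt m l'.
Proof.
move=> lY lY'; rewrite !mulr_sumr [RHS]big_mkcond; apply: eq_big_seq => m mY.
rewrite /pdown (mem_lower _ lY) mY /=.
case: ifP => um /=; last by rewrite mul0r mulr0.
have [um'|num'] := boolP (l' \in upper m); last by rewrite /pup (negbTE num') !mulr0.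
rewrite (pup_wt mY um') /levelN.
have := p_addn_neq0 n; have := dimY_neq0 lY; have := dimY_neq0 mY => ? ? ?.
by field; do ?[apply/andP; split] => //; rewrite addrC natr1.
Qed.

(** The two kernels are compared entry by entry: off the diagonal by [sum_wt_offdiag], on it by
    [sum_wt_diag], whose constant is [levelN n.+1 - levelN n]. *)
Lemma Tn_commutation n h l : l \in Yn n.+1 ->
  levelN n.+1 * T n.+1 h l
  = levelN n * downop n (upop n h) l + (2 * n.+1%:R + p) * h l.
Proof.
move=> lY.
have -> : levelN n.+1 * T n.+1 h l = \sum_(l' <- Yn n.+1)
    levelN n.+1 * (\sum_(nu <- Yn n.+2) pup z z' l nu * pdown R nu l') * h l'.
  rewrite /Tn; under eq_bigr do rewrite mulr_sumr.
  rewrite exchange_big mulr_sumr; apply: eq_bigr => l' _.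
  rewrite -mulrA; congr (_ * _); rewrite mulr_suml; apply: eq_bigr => nu _.
  by rewrite mulrA.
have -> : levelN n * downop n (upop n h) l = \sum_(l' <- Yn n.+1)
    levelN n * (\sum_(m <- Yn n) pdown R l m * pup z z' m l') * h l'.
  rewrite /downop /upop; under eq_bigr do rewrite mulr_sumr.
  rewrite exchange_big mulr_sumr; apply: eq_bigr => l' _.
  rewrite -mulrA; congr (_ * _); rewrite mulr_suml; apply: eq_bigr => nu _.
  by rewrite mulrA.
have -> : (2 * n.+1%:R + p) * h l
    = \sum_(l' <- Yn n.+1) (if l' == l then (2 * n.+1%:R + p) * h l' else 0).
  by rewrite -big_mkcond (@big_seq_unique _ _ _ _ _ l) ?uniq_Yn // => ? _ /eqP.
rewrite -big_split; apply: eq_big_seq => l' lY' /=.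
rewrite up_down_entry // down_up_entry //.
case: eqP => [->|/eqP nll]; last first.
  by rewrite addr0 sum_wt_offdiag // eq_sym.
rewrite divff ?(dimY_neq0 lY) // !mul1r -mulrDl; congr (_ * _).
under eq_bigl do rewrite andbb.
by rewrite sum_wt_diag //; under eq_bigl do rewrite -[_ \in _]andbb.
Qed.

Lemma upop_ext n g h l : {in Yn n.+1, g =1 h} -> upop n g l = upop n h l.
Proof. by move=> E; apply: eq_big_seq => nu /E ->. Qed.

Lemma downop_ext n g h l : {in Yn n, g =1 h} -> downop n g l = downop n h l.
Proof. by move=> E; apply: eq_big_seq => nu /E ->. Qed.

Lemma upop_lin n a b g h l :
  upop n (fun x => a * g x + b * h x) l = a * upop n g l + b * upop n h l.
Proof.
rewrite /upop !mulr_sumr -big_split; apply: eq_bigr => x _ /=; ring.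
Qed.

Lemma downop_lin n a b g h l :
  downop n (fun x => a * g x + b * h x) l = a * downop n g l + b * downop n h l.
Proof.
rewrite /downop !mulr_sumr -big_split; apply: eq_bigr => x _ /=; ring.
Qed.

Lemma downop_cst n c nu : nu \in Yn n.+1 -> downop n (fun=> c) nu = c.
Proof.
move=> nuY; rewrite /downop -mulr_suml.
have -> : \sum_(l <- Yn n) pdown R nu l = 1; last by rewrite mul1r.
have E : lower nu = [seq l <- Yn n | nu \in upper l].
  by rewrite /lower; move: nuY; rewrite mem_Yn => /andP[_ /eqP ->].
rewrite (eq_big_seq (fun l => if nu \in upper l then (dimY l)%:R / (dimY nu)%:R else 0)).
  rewrite -big_mkcond -big_filter -E -mulr_suml -natr_sum -(dimY_rec nuY).
  by rewrite divff // (dimY_neq0 nuY).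
by move=> l lY; rewrite /pdown (mem_lower _ nuY) lY.
Qed.

(** The up-probabilities are not summed directly: the commutation relation applied to a constant
    gives total mass 1 at level [n.+1] from level [n]. At the empty diagram the only box has weight
    [w 0 = p]. *)
Lemma upop_cst n c l : l \in Yn n -> upop n (fun=> c) l = c.
Proof.
elim: n c l => [|n IH] c l lY.
  rewrite /upop Yn1 big_seq1; move: lY; rewrite Yn0 inE => /eqP ->.
  rewrite (@pup_wt 0) // -[X in wt _ X]/(incr_nth [::] 0) wt_incr /wgt /content /= subrr.
  rewrite expr0n mulr0 !add0r !addr0 divff ?mul1r; last by rewrite gt_eqF ?p_gt0.
  by rewrite (_ : dimY _ = 1%N) // invr1 mul1r.
have E : T n.+1 (fun=> c) l = upop n.+1 (fun=> c) l.
  by apply: upop_ext => nu; apply: downop_cst.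
apply: (mulfI (lt0r_neq0 (levelN_gt0 n.+1))).
rewrite -E Tn_commutation // (@downop_ext _ _ (fun=> c)) ?downop_cst //.
  by rewrite levelNS [RHS]mulrDl.
by move=> x xY; exact: IH.
Qed.

Lemma Tn_cst n c l : l \in Yn n -> T n (fun=> c) l = c.
Proof.
move=> lY; rewrite TnE (@upop_ext _ _ (fun=> c)) ?upop_cst // => nu.
exact: downop_cst.
Qed.

Lemma Tn_ext n g h l : {in Yn n, g =1 h} -> T n g l = T n h l.
Proof. by move=> E; apply: upop_ext => nu _; apply: downop_ext. Qed.

Lemma Tn_lin n a b g h l :
  T n (fun x => a * g x + b * h x) l = a * T n g l + b * T n h l.
Proof.
by rewrite !TnE -upop_lin; apply: upop_ext => nu _; rewrite downop_lin.
Qed.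

Lemma upop_le n g h l : l \in Yn n -> {in Yn n.+1, forall x, g x <= h x} ->
  upop n g l <= upop n h l.
Proof.
move=> lY gh; rewrite /upop big_seq [in leRHS]big_seq; apply: ler_sum => nu nuY.
by rewrite ler_wpM2l ?gh // (pup_ge0 _ lY).
Qed.

Lemma downop_le n g h l : {in Yn n, forall x, g x <= h x} ->
  downop n g l <= downop n h l.
Proof.
move=> gh; rewrite /downop big_seq [in leRHS]big_seq; apply: ler_sum => nu nuY.
by rewrite ler_wpM2l ?gh // pdown_ge0.
Qed.

Lemma iter_Tn_ext n k g h : {in Yn n, g =1 h} ->
  {in Yn n, iter k (T n) g =1 iter k (T n) h}.
Proof. by move=> E; elim: k => //= k IH l _; apply: Tn_ext. Qed.

Lemma iter_Tn_lin n k a b g h : {in Yn n,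
  iter k (T n) (fun x => a * g x + b * h x)
  =1 fun l => a * iter k (T n) g l + b * iter k (T n) h l}.
Proof.
elim: k => //= k IH l lY; rewrite -Tn_lin; exact: Tn_ext.
Qed.

Lemma iter_Tn_cst n k c : {in Yn n, iter k (T n) (fun=> c) =1 fun=> c}.
Proof. by elim: k => //= k IH l lY; rewrite (Tn_ext _ IH) Tn_cst. Qed.

(* [ups k m h] averages a function [h] on Y_{m+k} over k up-steps started in
   Y_m; [downs k m g] averages [g] on Y_m over k down-steps started in Y_{m+k}. *)
Fixpoint ups (k m : nat) (h : seq nat -> R) : seq nat -> R :=
  if k is k'.+1 then upop m (ups k' m.+1 h) else h.

Fixpoint downs (k m : nat) (g : seq nat -> R) : seq nat -> R :=
  if k is k'.+1 then downs k' m.+1 (downop m g) else g.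

Lemma downs_ext k m g h : {in Yn m, g =1 h} ->
  {in Yn (m + k), downs k m g =1 downs k m h}.
Proof.
elim: k m g h => [|k IH] m g h E /=; first by rewrite addn0.
by rewrite addnS -addSn; apply: IH => nu _; apply: downop_ext.
Qed.

Lemma downs_lin k m a b g h : {in Yn (m + k),
  downs k m (fun x => a * g x + b * h x)
  =1 fun l => a * downs k m g l + b * downs k m h l}.
Proof.
elim: k m g h => [|k IH] m g h //=; rewrite addnS -addSn => l lY.
by rewrite -IH //; apply: downs_ext => // nu _; rewrite downop_lin.
Qed.

Lemma downs_cst k m c : {in Yn (m + k), downs k m (fun=> c) =1 fun=> c}.
Proof.
elim: k m => [|k IH] m //=; rewrite addnS -addSn => l lY.
by rewrite (@downs_ext _ _ _ (fun=> c)) ?IH // => nu; apply: downop_cst.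
Qed.

Lemma downs_le k m g h : {in Yn m, forall x, g x <= h x} ->
  {in Yn (m + k), forall x, downs k m g x <= downs k m h x}.
Proof.
elim: k m g h => [|k IH] m g h gh /=; first by rewrite addn0.
by rewrite addnS -addSn; apply: IH => nu _; apply: downop_le.
Qed.

Lemma ups_le k m g h : {in Yn (m + k), forall x, g x <= h x} ->
  {in Yn m, forall x, ups k m g x <= ups k m h x}.
Proof.
elim: k m => [|k IH] m /=; first by rewrite addn0.
by rewrite addnS -addSn => /IH gh l lY; apply: upop_le.
Qed.

Lemma ups_cst k m c : {in Yn m, ups k m (fun=> c) =1 fun=> c}.
Proof.
elim: k m => [|k IH] m //= l lY.
by rewrite (@upop_ext _ _ (fun=> c)) ?upop_cst // => nu; apply: IH.
Qed.

(** By the commutation relation, [levelN n] times [T n - 1] is intertwined by a single down-step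
    with the same operator one level lower; this is iterated [k] times. *)
Lemma Tn_downs k m g : {in Yn (m + k), forall l,
  levelN (m + k) * (T (m + k) (downs k m g) l - downs k m g l)
  = downs k m (fun x => levelN m * (T m g x - g x)) l}.
Proof.
elim: k m g => [|k IH] m g; first by rewrite addn0.
rewrite addnS -addSn => l lY /=; rewrite IH //; apply: downs_ext => // nu nuY.
rewrite mulrBr Tn_commutation // levelNS.
rewrite (_ : downop m (upop m _) nu = downop m (T m g) nu) //.
rewrite (@downop_ext _ (fun x => _ * _) (fun x => levelN m * T m g x + - levelN m * g x)).
  by rewrite downop_lin; ring.
by move=> x _; ring.
Qed.

(** The operator K_m, acting on functions on [Yn (m + k)]. *)
Definition downup k m (h : seq nat -> R) := downs k m (ups k m h).

(** After [Tn_downs], the commutation relation turns the operator at the bottom level into a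
    down-step followed by an up-step, which lengthens the excursion by one level. *)
Lemma Tn_downup k m h : {in Yn (m.+1 + k), forall l,
  levelN (m.+1 + k) * (T (m.+1 + k) (downup k m.+1 h) l - downup k m.+1 h l)
  = levelN m * (downup k.+1 m h l - downup k m.+1 h l)}.
Proof.
move=> l lY; rewrite /downup Tn_downs //=.
set g := ups k m.+1 h.
rewrite (@downs_ext _ _ _
  (fun x => levelN m * downop m (upop m g) x + - levelN m * g x)) //.
  by rewrite downs_lin //; ring.
move=> x xY; rewrite mulrBr Tn_commutation // levelNS; ring.
Qed.

(** * The z-measures and reversibility of the chain *)

Lemma poch_diag_real (l : seq nat) : exists2 V : R, 0 < V &
  poch_diag z l * poch_diag z' l = V%:C.
Proof.
exists (\prod_(i < size l) \prod_(0 <= j < nth 0%N l i) w (j%:R - i%:R)).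
  by do 2![apply: prodr_gt0 => ? _]; apply: content_wgt_gt0.
rewrite /poch_diag /poch_skew -big_split /= rmorph_prod; apply: eq_bigr => i _.
rewrite nth_nil -big_split /= rmorph_prod; apply: eq_bigr => j _.
by rewrite -[RHS]/((w _)%:C) -wgt_complex rmorphB /= !rmorph_nat !addrA.
Qed.

Lemma rising_real n : rising (z * z') n = (rising p n)%:C.
Proof.
rewrite /rising rmorph_prod; apply: eq_bigr => i _.
by rewrite zz_real rmorphD /= rmorph_nat.
Qed.

Lemma rising_gt0 n : 0 < rising p n.
Proof. by apply: prodr_gt0 => i _; apply: p_addn_gt0. Qed.

Lemma poch_diag_incr (y : R[i]) l i : is_partition l -> is_partition (incr_nth l i) ->
  poch_diag y (incr_nth l i) = poch_diag y l * (y + (nth 0%N l i)%:R - i%:R).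
Proof.
move=> Pl Pi; rewrite /poch_diag /poch_skew.
have sz : (size l <= size (incr_nth l i))%N by rewrite size_incr_nth; case: ifP => //; lia.
have il : (i < size (incr_nth l i))%N by rewrite size_incr_nth; case: ifP.
under eq_bigr do rewrite nth_nil.
under [in RHS]eq_bigr do rewrite nth_nil.
(* The added box may open a new row, so the product over the rows of [l] is padded with an empty
   row. *)
rewrite [X in _ = X * _](big_ord_widen_cond _ xpredT
  (fun k => \prod_(0 <= j < nth 0%N l k) (y + j%:R - k%:R)) sz) [X in _ = X * _]big_mkcond /=.
rewrite [X in _ = X * _](eq_bigr (fun k : 'I_(size (incr_nth l i)) => \prod_(0 <= j < nth 0%N l k) (y + j%:R - k%:R))) => [|k _]; last first.
  case: (ltnP k (size l)) => // kl.
  by rewrite [in RHS](nth_default 0%N kl) big_geq.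
rewrite (bigD1 (Ordinal il)) // [in RHS](bigD1 (Ordinal il)) //= nth_incr_nth eqxx add1n.
rewrite big_nat_recr //= -!mulrA; congr (_ * _); rewrite mulrC; congr (_ * _).
apply: eq_bigr => k ki; rewrite nth_incr_nth (_ : (i == k) = false) //.
by apply: contraNF ki => /eqP E; apply/eqP/val_inj.
Qed.

Lemma Mz_gt0 n l : l \in Yn n -> 0 < Mz z z' n l.
Proof.
move=> lY; have [V V0 VE] := poch_diag_real l.
rewrite /Mz VE rising_real -fmorph_div /= divr_gt0 ?ltr0n ?fact_gt0 //.
by rewrite mulr_gt0 ?divr_gt0 ?rising_gt0 // exprn_gt0 // ltr0n (dimY_gt0 lY).
Qed.

(** The added box multiplies the Pochhammer part of the z-measure by [wt l nu / (p + n)], which is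
    the factor in [pup]; the dimensions and factorials then match. *)
Lemma Mz_detailed_balance n l nu : l \in Yn n -> nu \in Yn n.+1 ->
  Mz z z' n l * pup z z' l nu = Mz z z' n.+1 nu * pdown R nu l.
Proof.
move=> lY nuY; rewrite /pdown (mem_lower _ nuY) lY /=.
case: ifP => [ul|nul]; last by rewrite /pup nul !mulr0.
rewrite (pup_wt lY ul); have [V V0 VE] := poch_diag_real l.
have VE' : poch_diag z nu * poch_diag z' nu = (V * wt l nu)%:C.
  rewrite rmorphM /= -VE -(wt_complex ul); have [i E P] := mem_upper _ _ ul.
  rewrite E !poch_skew_incr !poch_diag_incr -?E ?(upper_partition ul) //;
    try by move: lY; rewrite mem_Yn => /andP[].
  by rewrite rmorphB /= !rmorph_nat; ring.
rewrite /Mz VE VE' !rising_real -!fmorph_div /=.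
have -> : rising p n.+1 = rising p n * (p + n%:R) by rewrite /rising big_ord_recr.
rewrite factS natrM.
have := p_addn_neq0 n; have := dimY_neq0 lY; have := dimY_neq0 nuY => d1 d2 d3.
have := lt0r_neq0 (rising_gt0 n) => d4.
have d5 : (n`!)%:R != 0 :> R by rewrite pnatr_eq0 -lt0n fact_gt0.
by field; do ?[apply/andP; split] => //; rewrite addrC natr1.
Qed.

Definition Mavg n (h : seq nat -> R) : R := \sum_(l <- Yn n) Mz z z' n l * h l.

(** Up and down operators are adjoint for the z-measures, which makes their composition [T]
    symmetric. *)
Lemma Mavg_upop n g h :
  Mavg n (fun l => g l * upop n h l) = Mavg n.+1 (fun nu => downop n g nu * h nu).
Proof.
rewrite /Mavg /upop /downop.
under eq_bigr do rewrite mulrA mulr_sumr.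
rewrite exchange_big; apply: eq_big_seq => nu nuY /=.
rewrite mulr_suml mulr_sumr; apply: eq_big_seq => l lY /=.
by rewrite mulrACA [g l * h nu]mulrC mulrA Mz_detailed_balance //; ring.
Qed.

Lemma Mavg_ext n g h : {in Yn n, g =1 h} -> Mavg n g = Mavg n h.
Proof. by move=> E; apply: eq_big_seq => l /E ->. Qed.

Lemma Mavg_Tn_sym n g h :
  Mavg n (fun l => T n g l * h l) = Mavg n (fun l => g l * T n h l).
Proof.
rewrite (@Mavg_upop n g (downop n h)).
under [in RHS]Mavg_ext do rewrite mulrC.
by rewrite -Mavg_upop; apply: Mavg_ext => l _; rewrite mulrC.
Qed.

Lemma Mavg_iter_sym n k g h :
  Mavg n (fun l => iter k (T n) g l * h l) = Mavg n (fun l => g l * iter k (T n) h l).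
Proof.
elim: k g h => // k IH g h.
by rewrite iterSr IH /= Mavg_Tn_sym.
Qed.

Lemma Mavg_upop1 n h : Mavg n (upop n h) = Mavg n.+1 h.
Proof.
have := Mavg_upop n (fun=> 1) h.
rewrite (@Mavg_ext n _ (upop n h)) => [->|l _]; last by rewrite mul1r.
by apply: Mavg_ext => l lY; rewrite downop_cst ?mul1r.
Qed.

Lemma Mavg_ups k m h : Mavg m (ups k m h) = Mavg (m + k) h.
Proof.
elim: k m => [|k IH] m /=; first by rewrite addn0.
by rewrite Mavg_upop1 IH addnS addSn.
Qed.

Lemma Mavg0 h : Mavg 0 h = h [::].
Proof.
rewrite /Mavg Yn0 big_seq1 /Mz /poch_diag /poch_skew /rising !big_ord0.
have -> : complex.Re (1 * 1 / 1 : R[i]) = 1 by rewrite mulr1 divr1.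
by rewrite (_ : dimY _ = 1%N) // fact0 expr1n divr1 !mul1r.
Qed.

(** Climbing from the empty diagram produces the z-measure, and up-steps preserve constants; so its
    total mass is 1. *)
Lemma Mavg_cst n c : Mavg n (fun=> c) = c.
Proof. by rewrite -[n]add0n -Mavg_ups Mavg0 ups_cst. Qed.

Lemma Mavg_norm_le n h e : {in Yn n, forall l, `|h l| <= e} -> `|Mavg n h| <= e.
Proof.
move=> he; rewrite -[leRHS](Mavg_cst n) /Mavg; apply: le_trans (ler_norm_sum _ _ _) _.
rewrite big_seq [leRHS]big_seq; apply: ler_sum => l lY.
by rewrite normrM ger0_norm ?(ltW (Mz_gt0 lY)) // ler_pM2l ?he ?Mz_gt0.
Qed.

Lemma MavgB n g h : Mavg n (fun l => g l - h l) = Mavg n g - Mavg n h.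
Proof. by rewrite /Mavg -sumrB; apply: eq_bigr => l _; rewrite mulrBr. Qed.

Lemma Mavg_iter n k h : Mavg n (iter k (T n) h) = Mavg n h.
Proof.
have := Mavg_iter_sym n k h (fun=> 1).
rewrite (@Mavg_ext n _ (iter k (T n) h)) => [->|l _]; last by rewrite mulr1.
by apply: Mavg_ext => l lY; rewrite iter_Tn_cst ?mulr1.
Qed.

(** There is only one diagram with one box: reaching it forgets the starting point, and the climb
    back gives the z-average. *)
Lemma downup1 k h : {in Yn k.+1, downup k 1 h =1 fun=> Mavg k.+1 h}.
Proof.
move=> l; rewrite -add1n => lY; rewrite -Mavg_ups -[RHS](downs_cst _ lY).
apply: downs_ext => // x; rewrite Yn1 inE => /eqP ->.
rewrite -[LHS](Mavg_cst 1); apply: Mavg_ext => y; rewrite Yn1 inE => /eqP ->.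
by [].
Qed.

(* The level m performs, under T_n, a pure death chain with rates
   m (m - 1 + p) / levelN n; the function 1 - 1/m of the level contracts by
   1 - 1/levelN n. *)
Lemma iter_downup_bound k j m (B : R) h : {in Yn (m.+1 + j), forall l, `|h l| <= B} ->
  {in Yn (m.+1 + j), forall l,
  `|iter k (T (m.+1 + j)) (downup j m.+1 h) l - Mavg (m.+1 + j) h|
  <= 4 * B * (m%:R / m.+1%:R) * (1 - (levelN (m.+1 + j))^-1) ^+ k}.
Proof.
elim: k m j => [|k IH] [|m] j hB l lY.
- rewrite /= addSn add0n downup1 ?subrr ?normr0 ?mul0r ?mulr0 ?mul0r //.
- have B0 : 0 <= B by apply: le_trans (hB _ lY).
  have hb1 : {in Yn (m.+2 + j), forall l, h l <= B} by move=> x /hB; rewrite ler_norml => /andP[].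
  have hb2 : {in Yn (m.+2 + j), forall l, - B <= h l} by move=> x /hB; rewrite ler_norml => /andP[].
  have : `|downup j m.+2 h l| <= B.
    rewrite ler_norml /downup; apply/andP; split.
      rewrite -[leLHS](downs_cst _ lY); apply: downs_le lY => x xY.
      by rewrite -[leLHS](ups_cst j _ xY); apply: ups_le xY.
    rewrite -[leRHS](downs_cst _ lY); apply: downs_le lY => x xY.
    by rewrite -[leRHS](ups_cst j _ xY); apply: ups_le xY.
  have := Mavg_norm_le hB; rewrite /= expr0 mulr1 => M1 M2.
  apply: le_trans (ler_normB _ _) _.
  (* The constant 4 originates here: the trivial bound is [2 * B], and the level function is at
     least 1/2 from level 2 on. *)
  have : (2^-1 : R) <= m.+1%:R / m.+2%:R.
    rewrite ler_pdivlMr // mulrC ler_pdivrMr // -!natrM ler_nat; lia.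
  move=> h2; apply: le_trans (lerD M2 M1) _.
  have -> : B + B = 4 * B * 2^-1 by field.
  by apply: ler_wpM2l; rewrite ?mulr_ge0.
- rewrite /= -iterS (@iter_Tn_ext _ _ _ (fun=> Mavg (1 + j) h)) ?iter_Tn_cst //.
    by rewrite subrr normr0 mul0r mulr0 mul0r.
  by move=> x xY; rewrite downup1.
rewrite iterSr; set n := (m.+2 + j)%N.
(* The probability that the level drops from [m.+2] to [m.+1] in one step. *)
pose r := levelN m.+1 / levelN n.
have nE : n = (m.+1 + j.+1)%N by rewrite /n; lia.
have N0 := levelN_gt0 n.
rewrite (@iter_Tn_ext _ _ _
  (fun x => (1 - r) * downup j m.+2 h x + r * downup j.+1 m.+1 h x)) //; last first.
  move=> x xY; have := @Tn_downup j m.+1 h x xY; rewrite -/n => E.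
  apply: (mulfI (lt0r_neq0 N0)); rewrite /r; move: E; rewrite mulrBr => /(canRL (subrK _)) ->.
  by field; rewrite lt0r_neq0.
rewrite iter_Tn_lin //.
have := IH m.+1 j hB l lY; rewrite -/n => I1.
have := IH m j.+1; rewrite -nE => /(_ hB l lY) I2.
have r0 : 0 <= r by rewrite divr_ge0 ?ltW ?levelN_gt0.
have r1 : r <= 1.
  rewrite ler_pdivrMr // mul1r /levelN; apply: ler_pM; rewrite ?ltW ?p_addn_gt0 //.
    by rewrite ltr_nat /n; lia.
  by rewrite ltrD2l ltr_nat /n; lia.
have -> : forall a b c : R, (1 - r) * a + r * b - c = (1 - r) * (a - c) + r * (b - c) by move=> *; ring.
have convex a b : `|(1 - r) * a + r * b| <= (1 - r) * `|a| + r * `|b|.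
  apply: le_trans (ler_normD _ _) _.
  by rewrite normrM [`|r * b|]normrM (ger0_norm r0) ger0_norm ?subr_ge0.
apply: le_trans (convex _ _) _.
apply: le_trans (lerD (ler_wpM2l _ I1) (ler_wpM2l r0 I2)) _; first by rewrite subr_ge0.
rewrite exprS; set x := _ ^+ k.
have N1 : 1 <= levelN n by rewrite /n addSn levelN_ge1.
have x0 : 0 <= x by rewrite exprn_ge0 // subr_ge0 invf_le1.
have B0 : 0 <= B by apply: le_trans (hB _ lY).
(* A death lowers the level function by [1 / ((m + 1)(m + 2))]. Multiplied by [r] this is
   [(1 + p / (m + 1)) / levelN n], more than the decrease [(m + 1) / (m + 2) / levelN n] that is
   required. *)
have key : (1 - r) * (m.+1%:R / m.+2%:R) + r * (m%:R / m.+1%:R)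
    <= (1 - (levelN n)^-1) * (m.+1%:R / m.+2%:R).
  rewrite -subr_ge0 [X in 0 <= X](_ : _ = (levelN n)^-1 * (p / m.+1%:R + m.+2%:R^-1)).
    by rewrite mulr_ge0 ?addr_ge0 ?divr_ge0 ?invr_ge0 ?(ltW N0) ?(ltW p_gt0).
  have := lt0r_neq0 N0; rewrite /r /levelN; move: (_ * (p + n%:R)) => N N0'.
  rewrite -[m.+2]addn2 -[m.+1]addn1 !natrD.
  have m1 : m%:R + 1 != 0 :> R by rewrite natr1 pnatr_eq0.
  have m2 : m%:R + 2 != 0 :> R by rewrite -natrD addn2 pnatr_eq0.
  by field; do ?[apply/andP; split].
have := ler_wpM2r (mulr_ge0 (mulr_ge0 (ler0n R 4) B0) x0) key.
by congr (_ <= _); ring.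
Qed.

(** The case [j = 0] of the previous bound, where [downup] is the identity. *)
Lemma Tn_mixing n k (B : R) h : {in Yn n.+1, forall l, `|h l| <= B} ->
  {in Yn n.+1, forall l,
  `|iter k (T n.+1) h l - Mavg n.+1 h| <= 4 * B * (1 - (levelN n.+1)^-1) ^+ k}.
Proof.
move=> hB l lY; have := @iter_downup_bound k 0 n B h.
rewrite addn0 => /(_ hB l lY) H; apply: le_trans H _.
have N1 := levelN_ge1 n.
apply: ler_wpM2r; first by rewrite exprn_ge0 // subr_ge0 invf_le1 ?(lt_le_trans ltr01).
rewrite -[leRHS]mulr1; apply: ler_wpM2l.
  by rewrite mulr_ge0 //; apply: le_trans (hB _ lY).
by rewrite ler_pdivrMr // mul1r ler_nat.
Qed.

End UpDownChain.

(** * The Thoma simplex *)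

Section ThomaTopology.
Variable R : realType.
Local Notation Om := (Omega R).

Definition al (i : nat) (w : Om) : R := (set_val w : ambient R).1 i.
Definition be (i : nat) (w : Om) : R := (set_val w : ambient R).2 i.

Lemma cvg_sum_ord (S : Type) (F : set_system S) n (f : nat -> S -> R) (a : nat -> R) :
  Filter F -> (forall i, f i x @[x --> F] --> a i) ->
  \sum_(i < n) f i x @[x --> F] --> \sum_(i < n) a i.
Proof.
move=> FF fa; elim: n => [|n IH].
  by rewrite big_ord0; under eq_cvg do rewrite big_ord0; exact: cvg_cst.
by rewrite big_ord_recr; under eq_cvg do rewrite big_ord_recr; exact: cvgD.
Qed.

(** For nonnegative terms the series is bounded by 1 exactly when its partial sums are. Each
    condition then involves finitely many coordinates and passes to pointwise limits. *)
Lemma thomaP (x : ambient R) :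
  x \in @thoma R <->
  [/\ forall i, 0 <= x.1 i /\ 0 <= x.2 i,
      forall i, x.1 i.+1 <= x.1 i /\ x.2 i.+1 <= x.2 i &
      forall n, \sum_(i < n) (x.1 i + x.2 i) <= 1].
Proof.
split=> [/set_mem[pos dec sum1]|[pos dec sum1]]; last first.
  apply/mem_set; split => //; apply: lime_le.
    by apply: is_cvg_nneseries => i _ _; rewrite lee_fin; case: (pos i) => *; exact: addr_ge0.
  by apply: nearW => n; rewrite sumEFin lee_fin big_mkord.
split => // n; rewrite -lee_fin -sumEFin -(big_mkord xpredT (fun i => (x.1 i + x.2 i)%:E)).
apply: le_trans sum1; apply: nneseries_lim_ge => i _ _.
by rewrite lee_fin; case: (pos i) => *; exact: addr_ge0.
Qed.

Lemma Omega_thoma (w : Om) : [/\ forall i, 0 <= al i w /\ 0 <= be i w,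
      forall i, al i.+1 w <= al i w /\ be i.+1 w <= be i w &
      forall n, \sum_(i < n) (al i w + be i w) <= 1].
Proof. by apply/thomaP; rewrite /set_val /=; case: w. Qed.

(** The topology is induced from pointwise convergence of the two sequences, so limits of
    coordinates suffice. *)
Lemma Omega_cvg (F : set_system Om) (w : Om) : Filter F ->
  (forall i, al i x @[x --> F] --> al i w) ->
  (forall i, be i x @[x --> F] --> be i w) -> F --> w.
Proof.
move=> FF ca cb.
have c1 : (fun x : Om => (set_val x : ambient R).1) @ F --> (set_val w : ambient R).1.
  by apply/(@pointwise_cvgP _ _ _ (set_val w : ambient R).1) => i; exact: ca.
have c2 : (fun x : Om => (set_val x : ambient R).2) @ F --> (set_val w : ambient R).2.
  by apply/(@pointwise_cvgP _ _ _ (set_val w : ambient R).2) => i; exact: cb.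
have c3 : (fun x : Om => (set_val x : ambient R)) @ F --> (set_val w : ambient R).
  have -> : (fun x : Om => (set_val x : ambient R))
      = (fun x => ((set_val x : ambient R).1, (set_val x : ambient R).2)).
    by apply/funext => x; rewrite -surjective_pairing.
  exact: (cvg_pair c1 c2).
move=> U [/= V [[W oW <-] /= Wx sWU]].
by apply: filterS sWU _; apply: c3; apply: open_nbhs_nbhs.
Qed.

Lemma al_continuous i : continuous (al i).
Proof.
move=> w; rewrite /al.
apply: (@cvg_comp _ _ _ (fun x : Om => (set_val x : ambient R)) (fun y => y.1 i) _ (nbhs (set_val w : ambient R))).
  exact: (@initial_continuous _ _ (set_val : Om -> ambient R) w).
apply: (@cvg_comp _ _ _ (fun y : ambient R => y.1) (fun u => u i) _ (nbhs (set_val w : ambient R).1)).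
  exact: cvg_fst.
exact: (@proj_continuous _ (fun=> R) i (set_val w : ambient R).1).
Qed.

Lemma be_continuous i : continuous (be i).
Proof.
move=> w; rewrite /be.
apply: (@cvg_comp _ _ _ (fun x : Om => (set_val x : ambient R)) (fun y => y.2 i) _ (nbhs (set_val w : ambient R))).
  exact: (@initial_continuous _ _ (set_val : Om -> ambient R) w).
apply: (@cvg_comp _ _ _ (fun y : ambient R => y.2) (fun u => u i) _ (nbhs (set_val w : ambient R).2)).
  exact: cvg_snd.
exact: (@proj_continuous _ (fun=> R) i (set_val w : ambient R).2).
Qed.

Lemma al_itv i w : 0 <= al i w <= 1.
Proof.
have [pos _ /(_ i.+1)] := Omega_thoma w; rewrite big_ord_recr /= => s1.
have [-> b0] := pos i; apply: le_trans s1.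
have : 0 <= \sum_(k < i) (al k w + be k w).
  by apply: sumr_ge0 => k _; have [] := pos k; exact: addr_ge0.
by move=> ?; lra.
Qed.

Lemma be_itv i w : 0 <= be i w <= 1.
Proof.
have [pos _ /(_ i.+1)] := Omega_thoma w; rewrite big_ord_recr /= => s1.
have [b0 ->] := pos i; apply: le_trans s1.
have : 0 <= \sum_(k < i) (al k w + be k w).
  by apply: sumr_ge0 => k _; have [] := pos k; exact: addr_ge0.
by move=> ?; lra.
Qed.

(** Along an ultrafilter every coordinate converges in [[0, 1]], and the conditions of [thomaP] are
    closed, so the limit sequences form a point of the simplex. *)
Lemma Omega_compact : compact [set: Om].
Proof.
rewrite compact_ultra => F UF _.
have lim01 (f : Om -> R) : (forall w, 0 <= f w <= 1) -> exists l : R, f w @[w --> F] --> l.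
  move=> f01; have [|l [_ cl]] := @segment_compact R 0 1 (f @ F) _.
    suff : F (f @^-1` `[0, 1]) by [].
    by apply: filterE => w; rewrite /= in_itv /= f01.
  exists l => V Vl; have [//|FnV] := in_ultra_setVsetC (f @^-1` V) UF.
  by have [y []] := cl (~` V) V FnV Vl.
have [a ca] := @choice _ _ (fun i l => al i w @[w --> F] --> l) (fun i => lim01 (al i) (al_itv i)).
have [b cb] := @choice _ _ (fun i l => be i w @[w --> F] --> l) (fun i => lim01 (be i) (be_itv i)).
have ab : ((a, b) : ambient R) \in @thoma R.
  apply/thomaP; split => /= i.
  - split; [apply: (cvgr_to_ge (ca i)) | apply: (cvgr_to_ge (cb i))];
      by apply: filterE => w; have [/(_ i) []] := Omega_thoma w.
  - split; [apply: (ler_cvg_to (ca _) (ca _)) | apply: (ler_cvg_to (cb _) (cb _))];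
      by apply: filterE => w; have [_ /(_ i) []] := Omega_thoma w.
  - have cs : \sum_(k < i) (al k w + be k w) @[w --> F] --> \sum_(k < i) (a k + b k).
      apply: (@cvg_sum_ord _ F i (fun k w => al k w + be k w) (fun k => a k + b k)) => k.
      exact: (cvgD (ca k) (cb k)).
    apply: (cvgr_to_le cs).
    by apply: filterE => w; have [_ _ /(_ i)] := Omega_thoma w.
exists (exist (fun x : ambient R => x \in @thoma R) _ ab); split => //.
by apply: Omega_cvg.
Qed.

Lemma continuous_bounded (f : Om -> R) : continuous f ->
  exists2 B, 0 < B & forall w, `|f w| <= B.
Proof.
move=> cf; have : compact (f @` [set: Om]).
  by apply: continuous_compact Omega_compact; apply: continuous_subspaceT.
move=> /compact_bounded[M [_ HM]]; exists (`|M| + 1); first by rewrite ltr_wpDl.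
move=> w; apply: HM; last by exists w.
by apply: le_lt_trans (ler_norm _) _; rewrite ltrDl.
Qed.

(** Pseudometrics reading finitely many coordinates; increasing in [m], they replace a metric on the
    simplex. *)
Definition ddist (m : nat) (x y : Om) : R :=
  \sum_(i < m) (`|al i x - al i y| + `|be i x - be i y|).

Lemma ddist_ge0 m x y : 0 <= ddist m x y.
Proof. by apply: sumr_ge0 => i _; rewrite addr_ge0. Qed.

Lemma ddistxx m x : ddist m x x = 0.
Proof. by rewrite /ddist big1 // => i _; rewrite !subrr !normr0 addr0. Qed.

Lemma ddist_triangle m x y t : ddist m x t <= ddist m x y + ddist m y t.
Proof.
rewrite /ddist -big_split; apply: ler_sum => i _ /=.
have := ler_distD (al i y) (al i x) (al i t).
have := ler_distD (be i y) (be i x) (be i t).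
by lra.
Qed.

Lemma ddist_sym m x y : ddist m x y = ddist m y x.
Proof.
by rewrite /ddist; apply: eq_bigr => i _; rewrite distrC [X in _ + X]distrC.
Qed.

Lemma ddist_mono m n x y : (m <= n)%N -> ddist m x y <= ddist n x y.
Proof.
move=> /subnKC <-; rewrite /ddist big_split_ord /= lerDl.
by apply: sumr_ge0 => i _; rewrite addr_ge0.
Qed.

Lemma ddist_continuous m x : continuous (ddist m x).
Proof.
move=> y; have FF : Filter (nbhs (y : Om)) := nbhs_filter y.
rewrite /ddist; apply: (@cvg_sum_ord _ (nbhs (y : Om)) m
  (fun i y => `|al i x - al i y| + `|be i x - be i y|)
  (fun i => `|al i x - al i y| + `|be i x - be i y|)) => i.
by apply: cvgD; apply: cvg_norm; apply: cvgB;
  do ?[exact: cvg_cst | exact: al_continuous | exact: be_continuous].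
Qed.

(** Coordinate [i] enters [ddist n] as soon as [n] exceeds [i], and is controlled from then on. *)
Lemma ddist_cvg (u : nat -> Om) (w : Om) :
  (forall n, ddist n w (u n) <= n.+1%:R^-1) -> u @ \oo --> w.
Proof.
move=> H.
have cv (f : nat -> R) l (i : nat) : (forall n, (i < n)%N -> `|l - f n| <= n.+1%:R^-1) ->
    f @ \oo --> l.
  move=> Hf; apply/cvgrPdist_le => e e0; near=> n.
  apply: le_trans (Hf n _) _; first by near: n; exact: nbhs_infty_gt.
  by apply/ltW; near: n; exact: near_infty_natSinv_lt (PosNum e0).
apply: Omega_cvg => i.
  apply: (cv _ _ i) => n lt_in; apply: le_trans (H n).
  rewrite /ddist (bigD1 (Ordinal lt_in)) //= -addrA lerDl addr_ge0 //.
  by apply: sumr_ge0 => k _; rewrite addr_ge0.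
apply: (cv _ _ i) => n lt_in; apply: le_trans (H n).
rewrite /ddist (bigD1 (Ordinal lt_in)) //= addrAC lerDr addr_ge0 //.
by apply: sumr_ge0 => k _; rewrite addr_ge0.
Unshelve. all: by end_near. Qed.

Lemma open_ddist (U : set Om) w : open U -> U w ->
  exists m, forall y, ddist m w y <= m.+1%:R^-1 -> U y.
Proof.
move=> oU Uw; apply: contrapT => nex.
have {}nex m : exists y, ddist m w y <= m.+1%:R^-1 /\ ~ U y.
  apply: contrapT => H; apply: nex; exists m => y dy; apply: contrapT => nUy.
  by apply: H; exists y.
have [u Hu] := choice nex.
have cu : u @ \oo --> w by apply: ddist_cvg => n; have [] := Hu n.
have /cu[N _ HN] : nbhs w U by exact: open_nbhs_nbhs.
by have [_] := Hu N; apply; apply: (HN N); rewrite /= leqnn.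
Qed.

(** Distance to the complement of [U], from which continuous approximations of the indicator of an
    open set are made. *)
Definition codist (U : set Om) m (x : Om) : R := inf [set ddist m x y | y in ~` U].

Section Codist.
Variable (U : set Om).
Hypothesis U0 : ~` U !=set0.

Let inf_codist m x : has_inf [set ddist m x y | y in ~` U].
Proof.
split; first by have [y Uy] := U0; exists (ddist m x y), y.
by exists 0 => _ [y _ <-]; exact: ddist_ge0.
Qed.

Lemma codist_ge0 m x : 0 <= codist U m x.
Proof.
apply: lb_le_inf; first by have [] := inf_codist m x.
by move=> _ [y _ <-]; exact: ddist_ge0.
Qed.

Lemma codist_out m x : ~ U x -> codist U m x = 0.
Proof.
move=> nUx; apply/eqP; rewrite eq_le codist_ge0 andbT.
by apply: ge_inf; [have [] := inf_codist m x | exists x => //; rewrite ddistxx].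
Qed.

Lemma codist_lip m x y : codist U m x <= codist U m y + ddist m x y.
Proof.
rewrite -lerBlDr; apply: lb_le_inf; first by have [] := inf_codist m y.
move=> _ [t Ut <-]; rewrite lerBlDr [leRHS]addrC.
apply: le_trans (ddist_triangle m x y t).
by apply: ge_inf; [have [] := inf_codist m x | exists t].
Qed.

Lemma codist_continuous m : continuous (codist U m).
Proof.
move=> x; have FF : Filter (nbhs (x : Om)) := nbhs_filter x.
apply/(@cvgrPdist_le _ _ _ (nbhs (x : Om))) => e e0.
have /(@cvgrPdist_le _ _ _ (nbhs (x : Om))) /(_ e e0) := @ddist_continuous m x x.
rewrite ddistxx.
apply: filterS => y; rewrite sub0r normrN ger0_norm ?ddist_ge0 // => de.
rewrite ler_distl; have := codist_lip m x y; have := codist_lip m y x.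
by rewrite [ddist m y x]ddist_sym; move=> *; apply/andP; split; lra.
Qed.

Lemma codist_mono m n x : (m <= n)%N -> codist U m x <= codist U n x.
Proof.
move=> mn; apply: lb_le_inf; first by have [] := inf_codist n x.
move=> _ [y Uy <-]; apply: le_trans (ddist_mono x y mn).
by apply: ge_inf; [have [] := inf_codist m x | exists y].
Qed.

Lemma codist_gt0 x : open U -> U x -> exists m, 0 < codist U m x.
Proof.
move=> oU Ux; have [m Hm] := open_ddist oU Ux; exists m.
apply: (@lt_le_trans _ _ (m.+1%:R^-1)); first by rewrite invr_gt0.
apply: lb_le_inf; first by have [] := inf_codist m x.
by move=> _ [y Uy <-]; rewrite leNgt; apply/negP => /ltW /Hm.
Qed.

End Codist.

(** * Probability measures are determined by continuous functions *)

Lemma continuous_measurable (f : Om -> R) :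
  continuous f -> measurable_fun [set: OmegaB R] f.
Proof.
move=> /continuousP cf; apply: (measurability _ (RGenOpens.measurableE R)).
move=> _ [_ [a [b ->] <-]]; rewrite setTI; apply: sub_sigma_algebra.
exact/cf/interval_open.
Qed.

Lemma continuous_integrable (P : probability (OmegaB R) R) (f : Om -> R) :
  continuous f -> P.-integrable [set: OmegaB R] (EFin \o f).
Proof.
move=> cf; apply: measurable_bounded_integrable => //.
- by rewrite [X in (X < _)%E](probability_setT P) ltry.
- exact: continuous_measurable.
have [B _ fB] := continuous_bounded cf.
exists B; split; first exact: num_real.
by move=> M BM w _; apply: le_trans (fB w) (ltW BM).
Qed.

Section Uniqueness.
Variables P Q : probability (OmegaB R) R.
Hypothesis PQ : forall f : Om -> R, continuous f ->
  (\int[P]_x (f x)%:E = \int[Q]_x (f x)%:E)%E.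

(** For open [U] with nonempty complement these increase to the indicator of [U]: in [U] the factor
    [k] eventually lifts a positive distance above 1, and outside [U] they vanish. Monotone
    convergence then applies. *)
Let bump (U : set Om) (k : nat) (x : Om) : R := Num.min 1 (k%:R * codist U k x).

Lemma bump_cvg (S : probability (OmegaB R) R) (U : set Om) :
  open U -> ~` U !=set0 ->
  (\int[S]_x (bump U k x)%:E)%E @[k --> \oo] --> S (U : set (OmegaB R)).
Proof.
move=> oU U0.
have mU : measurable (U : set (OmegaB R)) by exact: sub_sigma_algebra.
have cbump k : continuous (bump U k).
  move=> x; have FF : Filter (nbhs (x : Om)) := nbhs_filter x.
  apply: (@continuous_min R Om (fun=> 1) (fun x => k%:R * codist U k x)).
    exact: cst_continuous.
  by apply: cvgM; [exact: cvg_cst | exact: codist_continuous].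
have -> : S (U : set (OmegaB R)) = (\int[S]_x (\1_U x)%:E)%E.
  by rewrite integral_indic ?setIT //.
have ptw x : (bump U k x)%:E @[k --> \oo] --> (\1_U x)%:E.
  apply: cvg_EFin; first exact: nearW.
  have [Ux|nUx] := pselect (U x); last first.
    rewrite indicE memNset //; apply: cvg_near_cst; apply: nearW => k.
    by rewrite /= /bump codist_out // mulr0 /Num.min ltr10.
  rewrite indicE mem_set //; apply: cvg_near_cst.
  have [m cm] := codist_gt0 U0 oU Ux.
  near=> k.
  rewrite /= /bump; apply/min_idPl.
  have km : codist U m x <= codist U k x.
    by apply: codist_mono => //; near: k; exact: nbhs_infty_ge.
  apply: le_trans (ler_wpM2l (ler0n _ k) km).
  rewrite -ler_pdivrMr // mul1r; apply: ltW; near: k; exact: nbhs_infty_gtr.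
have -> : (\int[S]_x (\1_U x)%:E = \int[S]_x limn (fun k => (bump U k x)%:E))%E.
  by apply: eq_integral => x _; apply/esym/cvg_lim => //; exact: ptw.
apply: cvg_monotone_convergence => //.
- by move=> k; apply/measurable_EFinP; exact: continuous_measurable.
- by move=> k x _; rewrite lee_fin /bump le_min ler01 mulr_ge0 ?codist_ge0.
- move=> x _ m n mn; rewrite lee_fin /bump le_min; apply/andP; split.
    by rewrite ge_min lexx.
  rewrite ge_min; apply/orP; right.
  by apply: ler_pM; rewrite ?codist_ge0 ?ler_nat ?codist_mono.
Unshelve. all: by end_near. Qed.

Lemma probability_eq_continuous (A : set (OmegaB R)) : measurable A -> P A = Q A.
Proof.
apply: (@measure_unique _ R (OmegaB R) (@open Om) (fun=> setT)) => //.
- exact: openI.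
- by move=> _; exact: openT.
- by rewrite bigcup_const //; exists 0%N.
(* [codist] is an infimum over the complement, so the whole space is treated apart. *)
- move=> U oU; have [U0|/set0P U0] := eqVneq (~` U) set0.
    have -> : U = setT by rewrite -[U]setCK U0 setC0.
    exact: etrans (probability_setT P) (esym (probability_setT Q)).
  have h1 := bump_cvg (S := P) oU U0; have h2 := bump_cvg (S := Q) oU U0.
  apply: (cvg_unique (@ereal_hausdorff R) h1).
  suff -> : (fun k => (\int[P]_x (bump U k x)%:E)%E)
      = (fun k => (\int[Q]_x (bump U k x)%:E)%E) by [].
  apply/funext => k; apply: PQ => x; have FF : Filter (nbhs (x : Om)) := nbhs_filter x.
  apply: (@continuous_min R Om (fun=> 1) (fun x => k%:R * codist U k x)).
    exact: cst_continuous.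
  by apply: cvgM; [exact: cvg_cst | exact: codist_continuous].
- by move=> _; rewrite [X in (X < _)%E](probability_setT P) ltry.
Qed.

End Uniqueness.

End ThomaTopology.

(** * Density of the embedded diagrams *)

Section Conjugate.
Local Open Scope nat_scope.
Implicit Types (l a b : seq nat).

(** Both sides say that the box in row [i] and column [k] belongs to the diagram. *)
Lemma lt_conj_row l i k : sorted geq l -> (i < conj_row l k) = (k < nth 0 l i).
Proof.
elim: l i => [|x l IH] i /=; first by rewrite nth_nil.
move=> pl; have sl := path_sorted pl.
have lx : all (geq x) l by apply: order_path_min pl => ? ? ? /[swap]; exact: leq_trans.
have c0 : x <= k -> conj_row l k = 0.
  move=> xk; apply/eqP; rewrite -leqn0 leqNgt -has_count -all_predC.
  by apply: sub_all lx => y /= yx; rewrite -leqNgt (leq_trans yx).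
rewrite /conj_row /= -/(conj_row l k); case: (ltnP k x) => kx /=.
  by case: i => [|i] /=; rewrite ?kx // add1n ltnS IH.
rewrite c0 //; case: i => [|i] /=; first by rewrite [k < x]ltnNge kx.
by rewrite -IH // c0.
Qed.

Lemma conj_row_le l i j : i <= j -> conj_row l j <= conj_row l i.
Proof. by move=> ij; apply: sub_count => r /=; exact: leq_ltn_trans. Qed.

Lemma conj_row_eq l k c : sorted geq l ->
  (forall i, (k < nth 0 l i) = (i < c)) -> conj_row l k = c.
Proof.
move=> sl H; have := lt_conj_row c k sl; have := lt_conj_row (conj_row l k) k sl.
by rewrite !H; lia.
Qed.

Lemma conj_row0 l k : sumn l <= k -> conj_row l k = 0.
Proof.
elim: l => //= x l IH xlk; rewrite /conj_row /= -/(conj_row l k) IH; lia.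
Qed.

Lemma sum_conj_row l n : sumn l <= n -> \sum_(k < n) conj_row l k = sumn l.
Proof.
elim: l => [|x l IH] /= xln; first by rewrite big1.
under eq_bigr do rewrite /conj_row /= -/(conj_row l _).
rewrite big_split /= IH; last lia.
congr (_ + _); rewrite -[RHS](subKn (_ : x <= n)) //; last lia.
rewrite -(big_mkord xpredT (fun k => (k < x) : nat)) (@big_cat_nat _ _ _ x) /=; try lia.
rewrite big_nat (eq_bigr (fun=> 1)) => [|k /andP[_ ->//]].
rewrite -big_nat sum_nat_const_nat big_nat big1 => [|k /andP[xk _]]; last by rewrite ltnNge xk.
by lia.
Qed.

Lemma sumn_map_predn l : sumn (map predn l) + conj_row l 0 = sumn l.
Proof.
elim: l => //= x l IH; rewrite /conj_row /= -/(conj_row l 0).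
by case: x => [|x] /=; lia.
Qed.

(* Rows from [a] glued to the right, and columns from [b] glued below, an
   [H] x [M] rectangle, plus [e] extra boxes in the first row. *)
Lemma ex_glued_diagram K H M e a b :
  sorted geq a -> sorted geq b -> size a <= K -> size b <= K ->
  0 < K -> K <= M -> K <= H ->
  exists l, [/\ l \in Yn (H * M + e + sumn a + sumn b),
    forall i, i < K -> nth 0 l i = M + nth 0 a i + (i == 0) * e &
    forall i, i < K -> conj_row l i = H + nth 0 b i].
Proof.
move=> sa sb aK bK K0 KM KH.
have geq_tr : transitive geq by move=> x y z xy yz; exact: leq_trans yz xy.
have mono s : sorted geq s -> forall i, nth 0 s i.+1 <= nth 0 s i.
  move=> ss i; case: (ltnP i.+1 (size s)) => [lt|/(nth_default 0)->//].
  by have := sorted_leq_nth geq_tr leqnn 0 ss i i.+1; rewrite !inE; apply; lia.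
have cb t : conj_row b t <= K by apply: leq_trans bK; exact: count_size.
(* Below the rectangle the rows are those of the conjugate of [b]. By [cb] they have length at most
   [K], hence at most [M], so [f] stays nonincreasing across row [H]. *)
pose f i := if i < H then M + nth 0 a i + (i == 0) * e else conj_row b (i - H).
have [||l Pl lf] := @partition_of_fun f (H + sumn b).
- move=> i; rewrite /f; case: (ltnP i H) => iH; last first.
    rewrite ltnNge (leq_trans iH (leqnSn i)) /=; apply: conj_row_le; lia.
  case: ltnP => iH'; last by have := cb (i.+1 - H); lia.
  have := mono _ sa i; rewrite /=; lia.
- by rewrite /f ltnNge leq_addr /= addKn conj_row0.
have nthK i : i < K -> nth 0 l i = M + nth 0 a i + (i == 0) * e.
  by move=> iK; rewrite lf /f (leq_trans iK KH).
exists l; split => //; last first.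
  move=> i iK; apply: conj_row_eq; first by case/andP: Pl.
  move=> k; rewrite lf /f; case: (ltnP k H) => kH; first lia.
  rewrite lt_conj_row //; lia.
rewrite mem_Yn Pl /=; apply/eqP.
rewrite (@sumnE_nth l (H + (sumn b + size l))); last lia.
under eq_bigr do rewrite lf.
rewrite big_split_ord /=.
under eq_bigr => i _ do rewrite /f ltn_ord.
under [X in _ + X]eq_bigr => i _ do rewrite /f ltnNge leq_addr /= addKn.
rewrite sum_conj_row ?leq_addr // !big_split /= sum_nat_const card_ord.
rewrite -(@sumnE_nth a H) ?(leq_trans aK) //.
have H0 : 0 < H by exact: leq_trans KH.
rewrite (bigD1 (Ordinal H0)) //= big1 ?addn0; first lia.
by move=> i /eqP i0; case: eqP => // E; case: i0; apply/val_inj.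
Qed.

End Conjugate.

Section Density.
Variable R : realType.
Local Notation Om := (Omega R).

(** The common form of [frob_a] and [frob_b], where [u] gives the row or the column lengths. *)
Let frob (u : nat -> nat) k : R := if (k < u k)%N then (u k)%:R - k%:R - 2^-1 else 0.

Lemma frob_ge0 u k : 0 <= frob u k.
Proof.
rewrite /frob; case: ifP => // ku.
have : (k%:R + 1 <= (u k)%:R :> R) by rewrite natr1 ler_nat.
by move=> ?; lra.
Qed.

Lemma frob_decr u k : (u k.+1 <= u k)%N -> frob u k.+1 <= frob u k.
Proof.
move=> uk; rewrite {1}/frob; case: ifP => kuS; last exact: frob_ge0.
rewrite /frob ifT; last lia.
have : ((u k.+1)%:R <= (u k)%:R :> R) by rewrite ler_nat.
by rewrite -natr1 => ?; lra.
Qed.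

(** Deleting the first row and column lowers both the length and the diagonal position by one. The
    second alternative covers lengths that do not reach past the diagonal. *)
Lemma frob_shift u v k : (forall j, u j.+1 = (v j).+1 \/ (u j.+1 <= j.+1)%N /\ v j = 0%N) ->
  frob u k.+1 = frob v k.
Proof.
move=> uv; rewrite /frob; have [->|[ukk ->]] := uv k.
  by rewrite ltnS; case: ifP => // _; rewrite -!natr1; ring.
by rewrite ltnNge ukk.
Qed.

(* Peeling off the first hook, of length [a_1 + b_1]. *)
Lemma sum_frob_le l n : sorted geq l ->
  \sum_(k < n) (frob_a R l k + frob_b R l k) <= (sumn l)%:R.
Proof.
elim: n l => [|n IH] l sl; first by rewrite big_ord0.
case: l sl => [|x l] sl.
  rewrite big1 // => k _; rewrite /frob_a /frob_b /conj_row /= nth_nil.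
  by rewrite ltn0 addr0.
have lx : all (geq x) l.
  by move: sl => /= pl; apply: order_path_min pl => ? ? ? /[swap]; exact: leq_trans.
have ltail : sorted geq (map predn l).
  by move: sl => /= /path_sorted; apply: homo_sorted => i j /=; lia.
have hcount k : (x <= k)%N -> conj_row l k = 0%N.
  move=> xk; apply/eqP; rewrite -leqn0 leqNgt -has_count -all_predC.
  by apply: sub_all lx => y /= yx; rewrite -leqNgt (leq_trans yx).
have hmap k : conj_row (map predn l) k = conj_row l k.+1.
  by rewrite /conj_row count_map; apply: eq_count => r /=; lia.
rewrite big_ord_recl.
have -> : \sum_(i < n) (frob_a R (x :: l) (lift ord0 i) + frob_b R (x :: l) (lift ord0 i))
    = \sum_(i < n) (frob_a R (map predn l) i + frob_b R (map predn l) i).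
  apply: eq_bigr => i _; rewrite /= /bump add1n; congr (_ + _).
    apply: (@frob_shift (nth 0%N (x :: l)) (nth 0%N (map predn l))) => j /=.
    case: (ltnP j (size l)) => jl; last by rewrite !nth_default ?size_map //; right.
    by rewrite (nth_map 0%N) //; case: (nth 0%N l j) => [|m]; [right|left].
  apply: (@frob_shift (conj_row (x :: l)) (conj_row (map predn l))) => j /=.
  rewrite hmap {1 2}/conj_row /= -/(conj_row l j.+1).
  by case: ltnP => xj; [left | right; rewrite hcount].
have := IH _ ltail; have := sumn_map_predn l; move=> /= <-.
rewrite natrD (natrD _ _ (conj_row l 0)) => Sn.
(* The corner box lies in both the first row and the first column; the two halves subtracted make it
   count once. *)
suff : frob_a R (x :: l) 0 + frob_b R (x :: l) 0 <= x%:R + (conj_row l 0)%:R.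
  by move=> ?; lra.
rewrite /frob_a /frob_b {1 2}/conj_row /= -/(conj_row l 0).
case: (posnP x) => [x0|x0] /=.
  by rewrite x0 hcount ?x0 //= !addr0.
by rewrite natrD; lra.
Qed.

Lemma iota_pt_thoma n l : (0 < n)%N -> l \in Yn n -> iota_pt R n l \in @thoma R.
Proof.
move=> n0; rewrite mem_Yn => /andP[Pl /eqP sl]; apply/thomaP; split => /= i.
- by split; rewrite mulr_ge0 ?invr_ge0 //;
    [exact: (@frob_ge0 (nth 0%N l)) | exact: (@frob_ge0 (conj_row l))].
- split; rewrite ler_wpM2r ?invr_ge0 //.
    by apply: (@frob_decr (nth 0%N l)); case/partitionP: Pl.
  by apply: (@frob_decr (conj_row l)); exact: conj_row_le.
under eq_bigr do rewrite -mulrDl.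
rewrite -mulr_suml ler_pdivrMr ?ltr0n // mul1r -sl.
by apply: sum_frob_le; case/andP: Pl.
Qed.

(** For positive [n] the embedded point lies in the simplex, so the default branch of [iota_n] is
    not taken on [Yn n]. *)
Lemma iota_n_coord n l : (0 < n)%N -> l \in Yn n ->
  forall i, al i (iota_n R n l) = frob_a R l i / n%:R /\
            be i (iota_n R n l) = frob_b R l i / n%:R.
Proof.
move=> n0 lY i; rewrite /iota_n; case: pselect => [h|]; last by have := iota_pt_thoma n0 lY.
by rewrite /al /be set_valE.
Qed.

Lemma sorted_mkseq_truncn (g : nat -> R) K : (forall i, g i.+1 <= g i) ->
  sorted geq (mkseq (fun i => Num.truncn (g i)) K).
Proof.
move=> dec; apply/(sortedP 0%N) => i; rewrite size_mkseq => iK.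
by rewrite !nth_mkseq ?(ltnW iK) //= le_truncn.
Qed.

(** The rounded multiples of the [al i w] extend the rows, those of the [be i w] the columns. The
    remaining boxes fill a rectangle whose width [M] depends on [m] only and whose height is at most
    [n / M]. *)
Lemma iota_n_dense m N (w : Om) : exists n l,
  [/\ (N <= n)%N, (0 < n)%N, l \in Yn n & ddist m w (iota_n R n l) <= m.+1%:R^-1].
Proof.
(* The allowed error per coordinate is [1 / (2K^2)]. The choice [M = 4K^2] makes the height of the
   rectangle use at most half of it, and [n] is large enough to absorb the errors of order
   [K * M]. *)
pose K := m.+1; pose M := (4 * K * K)%N; pose n := (N + 20 * K * K * K * M)%N.
(* Scaling by [n - K * M] rather than [n] leaves at least [K * M] boxes for the rectangle, whose
   height is then at least [K]. *)
pose c : R := (n - K * M)%:R.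
have KMn : (K * M <= n)%N.
  rewrite /n; apply: leq_trans (leq_addl _ _).
  have -> : (20 * K * K * K * M = K * M * (20 * K * K))%N by ring.
  by rewrite leq_pmulr // !muln_gt0.
have [pos dec s1] := Omega_thoma w.
pose A i := Num.truncn (c * al i w); pose B i := Num.truncn (c * be i w).
have c0 : 0 <= c by exact: ler0n.
have Ai i : (A i)%:R <= c * al i w < (A i).+1%:R.
  by apply: truncn_itv; rewrite mulr_ge0 //; case: (pos i).
have Bi i : (B i)%:R <= c * be i w < (B i).+1%:R.
  by apply: truncn_itv; rewrite mulr_ge0 //; case: (pos i).
pose a := mkseq A K; pose b := mkseq B K.
have sa : sorted geq a.
  by apply: (@sorted_mkseq_truncn (fun i => c * al i w)) => i; rewrite ler_wpM2l //; case: (dec i).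
have sb : sorted geq b.
  by apply: (@sorted_mkseq_truncn (fun i => c * be i w)) => i; rewrite ler_wpM2l //; case: (dec i).
have sab : (sumn a + sumn b <= n - K * M)%N.
  rewrite -(ler_nat R) (@sumnE_nth a K) ?size_mkseq // (@sumnE_nth b K) ?size_mkseq //.
  rewrite -big_split natr_sum -[leRHS]mulr1.
  apply: le_trans (ler_wpM2l c0 (s1 K)); rewrite mulr_sumr; apply: ler_sum => i _ /=.
  rewrite !nth_mkseq // natrD mulrDr.
  by have /andP[? _] := Ai i; have /andP[? _] := Bi i; exact: lerD.
pose r := (n - sumn a - sumn b)%N; pose H := (r %/ M)%N; pose e := (r %% M)%N.
have K0 : (0 < K)%N by [].
have KM : (K <= M)%N by rewrite /M leq_pmull.
have M0 : (0 < M)%N by exact: leq_trans KM.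
have KH : (K <= H)%N by rewrite /H leq_divRL // /r; lia.
have [l [lY la lb]] := @ex_glued_diagram K H M e a b sa sb
  (eq_leq (size_mkseq _ _)) (eq_leq (size_mkseq _ _)) K0 KM KH.
have nE : (H * M + e + sumn a + sumn b = n)%N by rewrite -divn_eq /r; lia.
rewrite nE in lY.
have n0 : (0 < n)%N by rewrite (leq_trans _ KMn) // muln_gt0.
exists n, l; split => //; first by rewrite /n leq_addr.
have nR : 0 < n%:R :> R by rewrite ltr0n.
have eM : (e < M)%N by rewrite ltn_mod.
have cE : c = n%:R - K%:R * M%:R by rewrite /c natrB // natrM.
have K1 : 1 <= K%:R :> R by rewrite ler1n.
have M1 : K%:R <= M%:R :> R by rewrite ler_nat.
have KMle : M%:R <= K%:R * M%:R :> R by rewrite ler_peMl.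
have big : 20 * K%:R ^+ 3 * M%:R <= n%:R :> R.
  by rewrite -natrX -!natrM ler_nat /n !expnS; lia.
have ME : M%:R = 4 * K%:R ^+ 2 :> R by rewrite -natrX -natrM /M expnS expn1 mulnA.
have close (x y : R) : `|n%:R * x - y| * (2 * K%:R ^+ 2) <= n%:R ->
    `|x - y / n%:R| <= (2 * K%:R ^+ 2)^-1.
  move=> h; have -> : x - y / n%:R = (n%:R * x - y) / n%:R.
    by rewrite mulrBl mulrAC divff ?mul1r // lt0r_neq0.
  rewrite normrM normfV (gtr0_norm nR) ler_pdivrMr // [leRHS]mulrC ler_pdivlMr //.
  by rewrite mulr_gt0 // exprn_gt0 // ltr0n.
have K3M : 0 <= K%:R ^+ 3 * M%:R :> R by [].
have alpha i : (i < K)%N -> `|al i w - al i (iota_n R n l)| <= (2 * K%:R ^+ 2)^-1.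
  move=> iK; have [-> _] := iota_n_coord n0 lY i.
  have iR : i%:R + 1 <= K%:R :> R by rewrite natr1 ler_nat.
  rewrite /frob_a la // nth_mkseq // ifT; last first.
    by rewrite -addnA (leq_trans iK) // (leq_trans KM) // leq_addr.
  have /andP[A1 A2] := Ai i; rewrite -natr1 in A2.
  rewrite [(M + A i + _)%:R]natrD [(M + A i)%:R]natrD.
  have : 0 <= (((i == 0%N) * e)%:R : R) <= M%:R.
    by rewrite ler0n ler_nat; case: eqP => _ /=; rewrite ?mul1n ?mul0n ?(ltnW eM).
  move: (((i == 0%N) * e)%:R) => x /andP[x0 xM].
  have /andP[al0 al1] := al_itv i w.
  have i0 : 0 <= i%:R :> R by [].
  have c2 : 0 <= K%:R * M%:R * al i w <= K%:R * M%:R.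
    by rewrite !mulr_ge0 // ler_piMr // mulr_ge0.
  rewrite cE mulrBl in A1 A2.
  apply: close.
  set y := (X in `|_ - X|); have D : `|n%:R * al i w - y| <= 5 * (K%:R * M%:R).
    by rewrite ler_norml /y; apply/andP; split; lra.
  apply: le_trans (ler_wpM2r _ D) _; first by rewrite mulr_ge0 ?exprn_ge0.
  by lra.
have beta i : (i < K)%N -> `|be i w - be i (iota_n R n l)| <= (2 * K%:R ^+ 2)^-1.
  move=> iK; have [_ ->] := iota_n_coord n0 lY i.
  have iR : i%:R + 1 <= K%:R :> R by rewrite natr1 ler_nat.
  rewrite /frob_b lb // nth_mkseq // ifT; last first.
    by rewrite (leq_trans iK) // (leq_trans KH) // leq_addr.
  have /andP[A1 A2] := Bi i; rewrite -natr1 in A2.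
  rewrite [(H + B i)%:R]natrD.
  have H0 : 0 <= H%:R :> R by [].
  have HM : H%:R * M%:R <= n%:R :> R by rewrite -natrM ler_nat -[leqRHS]nE -!addnA leq_addr.
  have /andP[al0 al1] := be_itv i w.
  have i0 : 0 <= i%:R :> R by [].
  have c2 : 0 <= K%:R * M%:R * be i w <= K%:R * M%:R.
    by rewrite !mulr_ge0 // ler_piMr // mulr_ge0.
  rewrite cE mulrBl in A1 A2.
  apply: close.
  set y := (X in `|_ - X|); have D : `|n%:R * be i w - y| <= H%:R + 3 * (K%:R * M%:R).
    by rewrite ler_norml /y; apply/andP; split; lra.
  apply: le_trans (ler_wpM2r _ D) _; first by rewrite mulr_ge0 ?exprn_ge0.
  rewrite ME in HM K3M big *; lra.
(* The two errors add up to [1 / K^2] for each of [m] indices, at most [1 / K] in total. *)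
apply: (@le_trans _ _ (\sum_(i < m) (K%:R ^+ 2)^-1)).
  apply: ler_sum => i _; have iK : (i < K)%N by rewrite ltnS ltnW.
  apply: le_trans (lerD (alpha i iK) (beta i iK)) _.
  by rewrite invfM; lra.
rewrite sumr_const card_ord -[_ *+ m]mulr_natr mulrC ler_pdivrMr ?exprn_gt0 //.
rewrite expr2 mulrA mulVf ?mul1r ?ler_nat //.
Qed.

End Density.

(** * The limit process *)

(** An elementary substitute for exponential decay: a bound of order [N / k] is enough for the limit
    in [t]. *)
Lemma bernoulli_decay (R : realType) (N : R) k : 1 <= N ->
  (1 - N^-1) ^+ k <= N / (N + k%:R).
Proof.
move=> N1; have N0 : 0 < N by exact: lt_le_trans N1.
elim: k => [|k IH]; first by rewrite expr0 addr0 divff ?lt0r_neq0.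
have h : 0 <= 1 - N^-1 by rewrite subr_ge0 invf_le1.
rewrite exprS; apply: le_trans (ler_wpM2l h IH) _.
have k0 : 0 <= k%:R :> R by [].
have P1 : 0 < N + k%:R by lra.
have P2 : 0 < N + k.+1%:R by rewrite -natr1; lra.
rewrite mulrA ler_pdivrMr // mulrAC ler_pdivlMr // mulrBl mul1r mulVf ?lt0r_neq0 //.
by rewrite -natr1; nra.
Qed.

Lemma fine_cvg_sum (R : realType) (u : nat -> R) (l : \bar R) :
  (u n)%:E @[n --> \oo] --> l -> l \is a fin_num -> u @ \oo --> fine l.
Proof. by move=> /[swap] /fineK {1}<- /fine_cvg. Qed.

Theorem theorem7p3 (R : realType) (z z' : R[i])
  (T : R -> (Omega R -> R) -> (Omega R -> R))
  (Pz : probability (OmegaB R) R) :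
  admissible z z' ->
  (* T(t) maps C(Omega) into C(Omega) *)
  (forall t f, 0 <= t -> continuous f -> continuous (T t f)) ->
  (* T is the semigroup of the context: T_n^[n^2 t] pi_n f approximates pi_n (T(t) f) *)
  (forall (f : Omega R -> R) (t : R), continuous f -> 0 <= t ->
     forall eps : R, 0 < eps -> exists N : nat, forall n : nat, (N <= n)%N ->
       forall l : seq nat, l \in Yn n ->
         `| iter (Num.truncn ((n%:R) ^+ 2 * t)) (Tn z z' n) (fun m => f (iota_n R n m)) l
            - T t f (iota_n R n l) | <= eps) ->
  (* P_{z,z'} is the weak limit of the pushforwards iota_n(M_n) *)
  (forall f : Omega R -> R, continuous f ->
     (fun n : nat => (\sum_(l <- Yn n) Mz z z' n l * f (iota_n R n l))%:E)
       @ \oo --> (\int[Pz]_x (f x)%:E)%E) ->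
  [/\
   (* (1) P_{z,z'} is the unique stationary distribution *)
   (forall (f : Omega R -> R) (t : R), continuous f -> 0 <= t ->
      (\int[Pz]_x (T t f x)%:E = \int[Pz]_x (f x)%:E)%E)
   /\ (forall P : probability (OmegaB R) R,
         (forall (f : Omega R -> R) (t : R), continuous f -> 0 <= t ->
            (\int[P]_x (T t f x)%:E = \int[P]_x (f x)%:E)%E) ->
         forall A : set (OmegaB R), measurable A -> P A = Pz A),
   (* (2) P_{z,z'} is a symmetrizing measure *)
   (forall (f g : Omega R -> R) (t : R), continuous f -> continuous g -> 0 <= t ->
      (\int[Pz]_x (T t f x * g x)%:E = \int[Pz]_x (f x * T t g x)%:E)%E) &
   (* (3) ergodicity: T(t) f -> (int f dP_{z,z'}) 1 uniformly on Omega *)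
   (forall f : Omega R -> R, continuous f ->
      forall eps : R, 0 < eps -> exists t0 : R, forall t : R, t0 <= t ->
        forall w : Omega R, `| T t f w - fine (\int[Pz]_x (f x)%:E)%E | <= eps)].
Proof.
move=> adm Tcont Tapprox Pzlim.
have int_fin (P : probability (OmegaB R) R) (f : Omega R -> R) : continuous f ->
    (\int[P]_x (f x)%:E)%E \is a fin_num.
  by move=> cf; apply: integrable_fin_num => //; exact: (continuous_integrable P cf).
pose pin (f : Omega R -> R) n (l : seq nat) := f (iota_n R n l).
have Mlim (f : Omega R -> R) : continuous f ->
    Mavg z z' n (pin f n) @[n --> \oo] --> fine (\int[Pz]_x (f x)%:E)%E.
  by move=> cf; apply: fine_cvg_sum; [exact: Pzlim | exact: int_fin].
(* Equality of limit integrals reduces to asymptotic agreement of z-averages, where the exact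
   reversibility of the finite chain is available. *)
have eq_int (f g : Omega R -> R) : continuous f -> continuous g ->
    (forall e, 0 < e -> exists N, forall n, (N <= n)%N ->
      `|Mavg z z' n (pin f n) - Mavg z z' n (pin g n)| <= e) ->
    (\int[Pz]_x (f x)%:E = \int[Pz]_x (g x)%:E)%E.
  move=> cf cg H; rewrite -(fineK (int_fin Pz _ cf)) -(fineK (int_fin Pz _ cg)).
  congr EFin; apply/eqP; rewrite -subr_eq0; apply/eqP.
  apply: (@cvg_unique _ (@Rhausdorff R) _ _ _ _ (cvgB (Mlim _ cf) (Mlim _ cg))).
  apply/cvgrPdist_le => e e0; have [N HN] := H e e0.
  by exists N => // n Nn /=; rewrite sub0r normrN; exact: HN.
have contM (f g : Omega R -> R) : continuous f -> continuous g ->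
    continuous (fun x => f x * g x).
  move=> cf cg x; have FF : Filter (nbhs (x : Omega R)) := nbhs_filter x.
  exact: (cvgM (cf x) (cg x)).
have sym (f g : Omega R -> R) t : continuous f -> continuous g -> 0 <= t ->
    (\int[Pz]_x (T t f x * g x)%:E = \int[Pz]_x (f x * T t g x)%:E)%E.
  move=> cf cg t0; apply: eq_int.
  - by apply: contM => //; exact: Tcont.
  - by apply: contM => //; exact: Tcont.
  move=> e e0; have [Bf Bf0 fB] := continuous_bounded cf.
  have [Bg Bg0 gB] := continuous_bounded cg.
  (* Multiplication by [g], bounded by [Bg], turns this tolerance into [e / 2]. *)
  have [|N1 H1] := Tapprox f t cf t0 (e / (2 * Bg)); first by rewrite divr_gt0 ?mulr_gt0.
  have [|N2 H2] := Tapprox g t cg t0 (e / (2 * Bf)); first by rewrite divr_gt0 ?mulr_gt0.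
  exists (maxn N1 N2) => n; rewrite geq_max => /andP[n1 n2].
  pose k := Num.truncn (n%:R ^+ 2 * t).
  have E := Mavg_iter_sym adm n k (pin f n) (pin g n).
  have D1 : `|Mavg z z' n (fun l => iter k (Tn z z' n) (pin f n) l * pin g n l)
      - Mavg z z' n (pin (fun x => T t f x * g x) n)| <= e / 2.
    rewrite -MavgB; apply: Mavg_norm_le => // l lY.
    rewrite -mulrBl normrM; apply: le_trans (ler_pM _ _ (H1 n n1 l lY) (gB _)) _ => //.
    by rewrite invfM mulrA mulfVK ?lt0r_neq0.
  have D2 : `|Mavg z z' n (fun l => pin f n l * iter k (Tn z z' n) (pin g n) l)
      - Mavg z z' n (pin (fun x => f x * T t g x) n)| <= e / 2.
    rewrite -MavgB; apply: Mavg_norm_le => // l lY.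
    rewrite -mulrBr normrM mulrC; apply: le_trans (ler_pM _ _ (H2 n n2 l lY) (fB _)) _ => //.
    by rewrite invfM mulrA mulfVK ?lt0r_neq0.
  rewrite E in D1; move: D1 D2; rewrite !ler_norml => /andP[? ?] /andP[? ?].
  by apply/andP; split; lra.
have stat (f : Omega R -> R) t : continuous f -> 0 <= t ->
    (\int[Pz]_x (T t f x)%:E = \int[Pz]_x (f x)%:E)%E.
  move=> cf t0; apply: eq_int => //; first exact: Tcont.
  move=> e e0; have [N H] := Tapprox f t cf t0 e e0.
  exists N => n Nn; rewrite -(Mavg_iter adm n (Num.truncn (n%:R ^+ 2 * t)) (pin f n)).
  rewrite -MavgB; apply: Mavg_norm_le => // l lY.
  by rewrite distrC; exact: H.
have ergo (f : Omega R -> R) : continuous f ->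
    forall eps : R, 0 < eps -> exists t0 : R, forall t : R, t0 <= t ->
      forall w : Omega R, `| T t f w - fine (\int[Pz]_x (f x)%:E)%E | <= eps.
  move=> cf eps eps0; have [B B0 fB] := continuous_bounded cf.
  pose p := complex.Re (z * z').
  have p0 : 0 < p := p_gt0 adm.
  (* The mixing bound [4 * B * N / (N + k)], with [N] at most [2 (1 + p) n^2] and [N + k] at least
     [n^2 t], is at most [8 * B * (1 + p) / t]; this threshold makes it at most [eps / 4]. *)
  exists (32 * B * (1 + p) / eps) => t tbig w.
  have t0 : 0 < t.
    by apply: lt_le_trans tbig; rewrite divr_gt0 // !mulr_gt0 // addr_gt0.
  have e4 : 0 < eps / 4 by rewrite divr_gt0.
  have [N1 H1] := Tapprox f t cf (ltW t0) _ e4.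
  have [N2 _ H2] : \forall n \near \oo,
      `|fine (\int[Pz]_x (f x)%:E)%E - Mavg z z' n (pin f n)| <= eps / 4.
    by have /cvgrPdist_le := Mlim f cf; apply.
  (* The chain controls [T t f] only at embedded diagrams. Those of arbitrarily large size
     accumulate at [w], where continuity of [T t f] concludes. *)
  have dense m : exists nl : nat * seq nat,
      [/\ (maxn N1 N2 <= nl.1)%N, (0 < nl.1)%N, nl.2 \in Yn nl.1 &
          ddist m w (iota_n R nl.1 nl.2) <= m.+1%:R^-1].
    by have [n [l Hnl]] := iota_n_dense m (maxn N1 N2) w; exists (n, l).
  have [u Hu] := choice dense.
  have cu : (fun m => iota_n R (u m).1 (u m).2) @ \oo --> w.
    by apply: ddist_cvg => m; have [] := Hu m.
  have cTu : T t f (iota_n R (u m).1 (u m).2) @[m --> \oo] --> T t f w.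
    exact: (cvg_comp _ _ cu (Tcont t f (ltW t0) cf w)).
  have [m0 _ Hm0] : \forall m \near \oo,
      `|T t f w - T t f (iota_n R (u m).1 (u m).2)| <= eps / 4.
    by have /cvgrPdist_le := cTu; apply.
  have := Hm0 m0 (leqnn m0); have [] := Hu m0.
  case: (u m0) => n l /=; rewrite geq_max => /andP[n1 n2] n0 lY _ D1.
  have D2 := H1 n n1 l lY; have /= D3 := H2 n n2.
  have D4 : `|iter (Num.truncn (n%:R ^+ 2 * t)) (Tn z z' n) (pin f n) l
      - Mavg z z' n (pin f n)| <= eps / 4.
    case: n n0 lY {n1 n2 D1 D2 D3} => // n _ lY.
    have mix := @Tn_mixing R z z' adm n (Num.truncn (n.+1%:R ^+ 2 * t)) B (pin f n.+1)
      (fun l _ => fB (iota_n R n.+1 l)) l lY.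
    apply: le_trans mix _.
    have N1' := levelN_ge1 adm n; set N := levelN z z' n.+1 in N1' *.
    set k := Num.truncn _.
    have N0 : 0 < N by exact: lt_le_trans N1'.
    (* Truncation loses less than 1, which [N >= 1] makes up for. *)
    have kt : n.+1%:R ^+ 2 * t < k%:R + 1.
      have x0 : 0 <= n.+1%:R ^+ 2 * t by rewrite mulr_ge0 ?exprn_ge0 // ltW.
      by rewrite natr1; have /andP[_] := truncn_itv x0.
    apply: le_trans (ler_wpM2l _ (bernoulli_decay k N1')) _; first by rewrite mulr_ge0 // ltW.
    have nR : 1 <= n.+1%:R :> R by rewrite ler1n.
    have NE : N <= 2 * (1 + p) * n.+1%:R ^+ 2.
      rewrite /N /levelN -/p -[n.+2%:R]natr1; move: (n.+1%:R) nR => x x1.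
      have -> : 2 * (1 + p) * x ^+ 2 = (x + x) * (x + p * x) by ring.
      have px : p <= p * x by rewrite ler_peMr // ltW.
      by apply: ler_pM; lra.
    have tb : 32 * B * (1 + p) <= eps * t by rewrite [leRHS]mulrC -ler_pdivrMr.
    have Nk : 0 < N + k%:R by rewrite ltr_wpDr.
    rewrite mulrA ler_pdivrMr //.
    have step1 : 4 * B * N <= 4 * B * (2 * (1 + p) * n.+1%:R ^+ 2).
      by rewrite ler_wpM2l // mulr_ge0 // ltW.
    apply: le_trans step1 _.
    have step2 : eps / 4 * (n.+1%:R ^+ 2 * t) <= eps / 4 * (N + k%:R).
      by rewrite ler_wpM2l ?(ltW e4) //; lra.
    apply: le_trans step2.
    have := ler_wpM2r (exprn_ge0 2 (ler0n R n.+1)) tb.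
    by move=> ?; lra.
  move: D1 D2 D3 D4; rewrite !ler_norml /pin => /andP[? ?] /andP[? ?] /andP[? ?] /andP[? ?].
  by apply/andP; split; lra.
(* Uniqueness: for large [t] the function [T t f] is uniformly close to its [Pz]-mean, while
   stationarity keeps its [P]-integral equal to that of [f]. So [P] and [Pz] agree on continuous
   functions. *)
split => //; split => // P Pst A mA; apply: probability_eq_continuous => // f cf.
rewrite -(fineK (int_fin P _ cf)) -(fineK (int_fin Pz _ cf)); congr EFin.
apply/eqP; rewrite -subr_eq0 -normr_le0; apply/ler_addgt0Pl => e e0; rewrite addr0.
have [t0 H] := ergo f cf e e0.
pose t := Num.max t0 0.
have tt0 : t0 <= t by rewrite le_max lexx.
have t00 : 0 <= t by rewrite le_max lexx orbT.
have cT := Tcont t f t00 cf.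
set c := fine (\int[Pz]_x (f x)%:E)%E.
rewrite -(Pst f t cf t00).
have E : (\int[P]_x (T t f x - c)%:E)%E = (fine (\int[P]_x (T t f x)%:E) - c)%:E.
  have ic : P.-integrable setT (EFin \o (fun _ : OmegaB R => c)).
    by apply: (@continuous_integrable R P (fun=> c)) => x; exact: cst_continuous.
  rewrite (integralB_EFin measurableT (continuous_integrable P cT) ic).
  rewrite integral_cst // [X in (_ - _ * X)%E](probability_setT P) mule1.
  by rewrite -{1}(fineK (int_fin P _ cT)) EFinB.
have : (`|\int[P]_x (T t f x - c)%:E| <= \int[P]_x e%:E)%E.
  apply: (le_trans (le_abse_integral P measurableT _)).
    apply/measurable_EFinP; apply: (@continuous_measurable R (fun x => T t f x - c)) => x.
    have FF : Filter (nbhs (x : Omega R)) := nbhs_filter x.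
    by apply: cvgB; [exact: cT | exact: cvg_cst].
  apply: ge0_le_integral => //.
  - apply/measurable_EFinP; apply: (@continuous_measurable R (fun x => `|T t f x - c|)) => x.
    have FF : Filter (nbhs (x : Omega R)) := nbhs_filter x.
    by apply: cvg_norm; apply: cvgB; [exact: cT | exact: cvg_cst].
  - by move=> x _; rewrite lee_fin; exact: H.
rewrite E integral_cst // [X in (_ <= _ * X)%E -> _](probability_setT P) mule1.
by rewrite lee_fin.
Qed.
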